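(* For $n\ge 3$, $$\tilde A_{n-1}^{CFC}(q)=P_{n-1}(q)+\frac{2^n-2}{1-q^n}\,q^{2n},$$ where $P_{n-1}(q)$ is a polynomial of degree $n$, and the polynomials $P_n(q)$ satisfy, for $n\ge 4$, $$P_n(q)=(3q+1)P_{n-1}(q)-(2q+2q^2)P_{n-2}(q)+q^2P_{n-3}(q),$$ with $P_1(q)=1+2q+2q^2$, $P_2(q)=1+3q+6q^2+6q^3$ and $P_3(q)=1+4q+10q^2+16q^3+14q^4$. Moreover, $$P(x):=\sum_{n=1}^{\infty}P_n(q)x^n=\frac{x\left(1+2q+2q^2-(2q+2q^2)x+q^2x^2\right)}{(1-qx)\left(1-(2q+1)x+qx^2\right)}.$$ Therefore the coefficients of $\tilde A_{n-1}^{CFC}(q)$ are ultimately periodic of exact period $n$, and the periodicity starts at length $n$.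
   Context: $\tilde A_{n-1}$ ($n\ge3$) is the affine Coxeter group with generators $s_0,\dots,s_{n-1}$ whose Coxeter diagram is the $n$-cycle $s_0-s_1-\cdots-s_{n-1}-s_0$ (all edges with $m=3$). For a Coxeter group $W$ with length $\ell$, an element is fully commutative (FC) if any two of its reduced expressions are related by a sequence of transpositions of adjacent commuting generators. A cyclic shift of a word $s_{i_1}\cdots s_{i_k}$ is any word $s_{i_j}\cdots s_{i_k}s_{i_1}\cdots s_{i_{j-1}}$. An element is cyclically fully commutative (CFC) if every cyclic shift of every one of its reduced expressions is a reduced expression of an FC element. $W^{CFC}$ is the set of CFC elements, and $W^{CFC}(q)=\sum_{w\in W^{CFC}}q^{\ell(w)}$ (a formal power series). A sequence $(a_k)_{k\ge0}$ is ultimately periodic of exact period $N$ with periodicity starting at length $L$ if $a_{k+N}=a_k$ for all $k\ge L$, $N$ is the least positive integer that is an eventual period, and $L$ is the least integer with this property. *)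

(* Defs.v *)
From HB Require Import structures.
From Stdlib Require Import Relations.
From mathcomp Require Import all_boot all_order all_algebra.
From mathcomp Require Import generic_quotient.
From mathcomp Require Import finmap.
From mathcomp Require Import boolp classical_sets cardinality.

Set Implicit Arguments.
Unset Strict Implicit.
Unset Printing Implicit Defensive.

Import GRing.Theory.

Section FormalPowerSeries.

Local Open Scope ring_scope.

Record fps (R : Type) := FPS { fcoef : nat -> R }.

Lemma fpsP (R : Type) (f g : fps R) : fcoef f =1 fcoef g -> f = g.
Proof. by case: f g => [f] [g] /= /funext ->. Qed.

HB.instance Definition _ (R : Type) := gen_eqMixin (fps R).
HB.instance Definition _ (R : Type) := gen_choiceMixin (fps R).

Section Zmodule.
Variable R : zmodType.
Implicit Types f g h : fps R.

Definition fps_add f g := FPS (fun n => fcoef f n + fcoef g n).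
Definition fps_opp f := FPS (fun n => - fcoef f n).
Definition fps_zero : fps R := FPS (fun=> 0).

Fact fps_addA : associative fps_add.
Proof. by move=> f g h; apply: fpsP => n /=; rewrite addrA. Qed.
Fact fps_addC : commutative fps_add.
Proof. by move=> f g; apply: fpsP => n /=; rewrite addrC. Qed.
Fact fps_add0 : left_id fps_zero fps_add.
Proof. by move=> f; apply: fpsP => n /=; rewrite add0r. Qed.
Fact fps_addN : left_inverse fps_zero fps_opp fps_add.
Proof. by move=> f; apply: fpsP => n /=; rewrite addNr. Qed.

HB.instance Definition _ :=
  GRing.isZmodule.Build (fps R) fps_addA fps_addC fps_add0 fps_addN.

Lemma fcoefD f g n : fcoef (f + g) n = fcoef f n + fcoef g n.
Proof. by []. Qed.
Lemma fcoefN f n : fcoef (- f) n = - fcoef f n.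
Proof. by []. Qed.
Lemma fcoef0 n : fcoef (0 : fps R) n = 0.
Proof. by []. Qed.
Lemma fcoef_sum (I : Type) (r : seq I) (P : pred I) (F : I -> fps R) n :
  fcoef (\sum_(i <- r | P i) F i) n = \sum_(i <- r | P i) fcoef (F i) n.
Proof.
by elim/big_rec2: _ => [|i y f _ <-]; rewrite ?fcoef0 ?fcoefD.
Qed.

End Zmodule.

Section Ring.
Variable R : comNzRingType.
Implicit Types f g h : fps R.

Definition fps_mul f g :=
  FPS (fun n => \sum_(j < n.+1) fcoef f j * fcoef g (n - j)%N).

Definition fps_poly (p : {poly R}) : fps R := FPS (fun n => p`_n).
Definition fpsC (c : R) : fps R := fps_poly c%:P.
Definition fpsX : fps R := fps_poly 'X.

Let trunc m f : {poly R} := \poly_(i < m) fcoef f i.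

Let coef_trunc m f n : (n < m)%N -> (trunc m f)`_n = fcoef f n.
Proof. by move=> lt_nm; rewrite coef_poly lt_nm. Qed.

Let fcoef_mul m f g n : (n < m)%N ->
  fcoef (fps_mul f g) n = (trunc m f * trunc m g)`_n.
Proof.
move=> lt_nm; rewrite coefM; apply: eq_bigr => -[j /= lt_jn] _.
by rewrite !coef_trunc //; apply: leq_ltn_trans lt_nm; rewrite ?leq_subr.
Qed.

Let coefM_eq (p q p' q' : {poly R}) n :
  (forall i, (i <= n)%N -> p`_i = p'`_i) ->
  (forall i, (i <= n)%N -> q`_i = q'`_i) -> (p * q)`_n = (p' * q')`_n.
Proof.
move=> eqp eqq; rewrite !coefM; apply: eq_bigr => -[j /= lt_jn] _.
by rewrite eqp // eqq // leq_subr.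
Qed.

Fact fps_mulC : commutative fps_mul.
Proof.
by move=> f g; apply: fpsP => n; rewrite !(@fcoef_mul n.+1) // mulrC.
Qed.

Fact fps_mulA : associative fps_mul.
Proof.
move=> f g h; apply: fpsP => n; rewrite !(@fcoef_mul n.+1) //.
transitivity ((trunc n.+1 f * (trunc n.+1 g * trunc n.+1 h))`_n).
  by apply: coefM_eq => // i le_in; rewrite coef_trunc // (@fcoef_mul n.+1).
rewrite mulrA; apply: coefM_eq => // i le_in.
by rewrite coef_trunc // (@fcoef_mul n.+1).
Qed.

Fact fps_mul1 : left_id (fps_poly 1) fps_mul.
Proof.
move=> f; apply: fpsP => n /=; rewrite big_ord_recl /= coef1 mul1r subn0.
by rewrite big1 ?addr0 // => i _; rewrite coef1 /= mul0r.
Qed.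

Fact fps_mulDl : left_distributive fps_mul (@fps_add R).
Proof.
move=> f g h; apply: fpsP => n /=; rewrite -big_split.
by apply: eq_bigr => i _; rewrite mulrDl.
Qed.

Fact fps_oner_neq0 : fps_poly 1 != 0.
Proof.
apply/eqP => /(congr1 (fun f => fcoef f 0)) /=; rewrite coef1 /= => /eqP.
by rewrite oner_eq0.
Qed.

HB.instance Definition _ := GRing.Zmodule_isComNzRing.Build (fps R)
  fps_mulA fps_mulC fps_mul1 fps_mulDl fps_oner_neq0.

Lemma fcoefM f g n :
  fcoef (f * g) n = \sum_(j < n.+1) fcoef f j * fcoef g (n - j)%N.
Proof. by []. Qed.

Lemma fcoefM0 f g : fcoef (f * g) 0 = fcoef f 0 * fcoef g 0.
Proof. by rewrite fcoefM big_ord1. Qed.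

Lemma fcoef1 n : fcoef (1 : fps R) n = (n == 0)%:R.
Proof. by rewrite /= coef1. Qed.

Fact fps_poly_is_zmod_morphism : zmod_morphism fps_poly.
Proof. by move=> p q; apply: fpsP => n /=; rewrite coefB. Qed.
HB.instance Definition _ :=
  GRing.isZmodMorphism.Build _ _ fps_poly fps_poly_is_zmod_morphism.

Fact fps_poly_is_monoid_morphism : monoid_morphism fps_poly.
Proof. by split=> // p q; apply: fpsP => n /=; rewrite coefM. Qed.
HB.instance Definition _ :=
  GRing.isMonoidMorphism.Build _ _ fps_poly fps_poly_is_monoid_morphism.

Lemma fcoef_exp_lt f k n : fcoef f 0 = 0 -> (n < k)%N -> fcoef (f ^+ k) n = 0.
Proof.
move=> f0; elim: k n => // k IHk n lt_nk; rewrite exprS fcoefM big1 // => i _.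
case: i => -[|i] /= lt_in; first by rewrite f0 mul0r.
by rewrite IHk ?mulr0 //; rewrite subnSK // (leq_trans (leq_subr _ _)).
Qed.

End Ring.

Section UnitRing.
Variable R : comUnitRingType.
Implicit Types f g h : fps R.

Definition fps_unit : {pred fps R} := fun f => fcoef f 0 \is a GRing.unit.

(* The geometric series of [1 - f / f_0], cut off where it stops contributing. *)
Definition fps_inv f : fps R :=
  if f \in fps_unit then
    let c := fpsC (fcoef f 0)^-1 in
    FPS (fun n => fcoef (c * \sum_(j < n.+1) (1 - c * f) ^+ j) n)
  else f.

Fact fps_mulV : {in fps_unit, left_inverse 1 fps_inv *%R}.
Proof.
move=> f fU; rewrite /fps_inv fU; set c := fpsC _; set u := 1 - c * f.
have u0 : fcoef u 0 = 0.
  rewrite fcoefD fcoefN fcoefM0 fcoef1 /= coefC /= mulVr ?subrr //.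
apply: fpsP => n; pose s := \sum_(j < n.+1) u ^+ j.
transitivity (fcoef ((c * s) * f) n).
  rewrite !fcoefM; apply: eq_bigr => -[i /= lt_in] _; congr (_ * _).
  rewrite -[LHS]/(fcoef (c * _) i) -[RHS]/(fcoef (c * _) i).
  rewrite !fcoefM; apply: eq_bigr => -[j /= lt_ji] _; congr (_ * _).
  rewrite /s !fcoef_sum -!(big_mkord xpredT (fun k => fcoef (u ^+ k) (i - j)%N)).
  rewrite [RHS](@big_cat_nat _ _ _ i.+1) //= [X in _ = _ + X]big_nat_cond.
  rewrite [X in _ = _ + X]big1 ?addr0 // => k /andP[/andP[le_ik _] _].
  by rewrite fcoef_exp_lt //; apply: leq_ltn_trans le_ik; rewrite leq_subr.
have -> : c * s * f = 1 - u ^+ n.+1.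
  have -> : c * s * f = (1 - u) * s by rewrite /u opprB addrC subrK mulrAC.
  by rewrite -[in RHS](expr1n _ n.+1) subrXX; congr (_ * _);
     apply: eq_bigr => i _; rewrite expr1n mul1r.
by rewrite fcoefD fcoefN fcoef_exp_lt // subr0.
Qed.

Fact fps_unitPl f g : g * f = 1 -> fps_unit f.
Proof.
move/(congr1 (fun h => fcoef h 0)); rewrite fcoefM0 fcoef1 => gf1.
by apply/unitrPr; exists (fcoef g 0); rewrite mulrC.
Qed.

Fact fps_inv_out : {in [predC fps_unit], fps_inv =1 id}.
Proof. by move=> f; rewrite inE /fps_inv => /negbTE ->. Qed.

HB.instance Definition _ := GRing.ComNzRing_hasMulInverse.Build (fps R)
  fps_mulV fps_unitPl fps_inv_out.

Lemma fps_unitE f : (f \is a GRing.unit) = (fcoef f 0 \is a GRing.unit).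
Proof. by []. Qed.

End UnitRing.

End FormalPowerSeries.

(* The value 0 stands for an infinite entry: the relator [(s_i s_j)^0] is
   then empty. *)
Record coxeterMatrix (I : finType) := CoxeterMatrix {
  cox_m :> I -> I -> nat;
  cox_m_diag : forall i, cox_m i i = 1;
  cox_m_sym : forall i j, cox_m i j = cox_m j i;
  cox_m_neq1 : forall i j, i != j -> cox_m i j != 1
}.

Section CoxeterGroup.

Variables (I : finType) (M : coxeterMatrix I).
Implicit Types s t u v : seq I.

Definition relator (i j : I) : seq I := flatten (nseq (M i j) [:: i; j]).

Definition cox_step s t : Prop :=
  exists u v i j, s = u ++ relator i j ++ v /\ t = u ++ v.

(* Since [m i i = 1] makes every generator an involution, the monoid given by
   these relators is the group they present. *)
Definition cox_cong : seq I -> seq I -> Prop :=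
  clos_refl_sym_trans (seq I) cox_step.

Definition cox_congb : rel (seq I) := fun s t => `[< cox_cong s t >].

Fact cox_congb_refl : reflexive cox_congb.
Proof. by move=> s; apply/asboolP; apply: rst_refl. Qed.
Fact cox_congb_sym : symmetric cox_congb.
Proof. by move=> s t; apply/asboolP/asboolP; apply: rst_sym. Qed.
Fact cox_congb_trans : transitive cox_congb.
Proof.
by move=> t s u /asboolP st /asboolP tu; apply/asboolP; apply: rst_trans tu.
Qed.

Canonical cox_equiv :=
  EquivRel cox_congb cox_congb_refl cox_congb_sym cox_congb_trans.

Definition coxGroup := {eq_quot cox_equiv}%qT.

HB.instance Definition _ := Choice.on coxGroup.
HB.instance Definition _ := EqQuotient.on coxGroup.

Local Notation pi := (\pi_coxGroup%qT).

Lemma cox_piP s t : reflect (cox_cong s t) (pi s == pi t).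
Proof. by rewrite eqmodE; apply: asboolP. Qed.

Lemma cox_cong_catl u s t : cox_cong s t -> cox_cong (u ++ s) (u ++ t).
Proof.
elim=> {s t} [s t [u' [v [i [j [-> ->]]]]]|s|s t _|s t r _ st _].
- by apply: rst_step; exists (u ++ u'), v, i, j; rewrite -!catA.
- exact: rst_refl.
- exact: rst_sym.
- exact: rst_trans st.
Qed.

Lemma cox_cong_catr u s t : cox_cong s t -> cox_cong (s ++ u) (t ++ u).
Proof.
elim=> {s t} [s t [u' [v [i [j [-> ->]]]]]|s|s t _|s t r _ st _].
- by apply: rst_step; exists u', (v ++ u), i, j; rewrite -!catA.
- exact: rst_refl.
- exact: rst_sym.
- exact: rst_trans st.
Qed.

Lemma cox_cong_cat s s' t t' :
  cox_cong s s' -> cox_cong t t' -> cox_cong (s ++ t) (s' ++ t').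
Proof.
by move=> /(cox_cong_catr t) ss' /(cox_cong_catl s'); apply: rst_trans ss'.
Qed.

Lemma cox_cong_sq i : cox_cong [:: i; i] [::].
Proof.
apply: rst_step; exists [::], [::], i, i; split => //.
by rewrite /relator cox_m_diag.
Qed.

Lemma cox_cong_revl s : cox_cong (rev s ++ s) [::].
Proof.
elim: s => [|i s IHs]; first exact: rst_refl.
rewrite rev_cons cat_rcons; apply: rst_trans IHs.
by apply: (cox_cong_catl (rev s)); apply: (cox_cong_catr s (cox_cong_sq i)).
Qed.

Lemma cox_cong_revr s : cox_cong (s ++ rev s) [::].
Proof. by rewrite -{1}(revK s); apply: cox_cong_revl. Qed.

Definition cox_one : coxGroup := pi [::].
Definition cox_mul (x y : coxGroup) : coxGroup := pi (repr x ++ repr y).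
Definition cox_inv (x : coxGroup) : coxGroup := pi (rev (repr x)).

Let pi_repr s : cox_cong (repr (pi s)) s.
Proof. by apply/cox_piP; rewrite reprK. Qed.

Let cox_mul_pi s t : cox_mul (pi s) (pi t) = pi (s ++ t).
Proof. by apply/eqP/cox_piP; apply: cox_cong_cat; apply: pi_repr. Qed.

Fact cox_mulA : associative cox_mul.
Proof.
move=> x y z; rewrite -[x]reprK -[y]reprK -[z]reprK.
rewrite (cox_mul_pi (repr y) (repr z)) (cox_mul_pi (repr x) (repr y)).
by rewrite (cox_mul_pi (repr x)) (cox_mul_pi (_ ++ _)) catA.
Qed.
Fact cox_mul1 : left_id cox_one cox_mul.
Proof. by move=> x; rewrite -[x]reprK cox_mul_pi. Qed.
Fact cox_mulr1 : right_id cox_one cox_mul.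
Proof. by move=> x; rewrite -[x]reprK cox_mul_pi cats0. Qed.
Fact cox_mulV : left_inverse cox_one cox_inv cox_mul.
Proof.
move=> x; rewrite -{2}[x]reprK cox_mul_pi.
by apply/eqP/cox_piP; apply: cox_cong_revl.
Qed.
Fact cox_mulVr : right_inverse cox_one cox_inv cox_mul.
Proof.
move=> x; rewrite -{1}[x]reprK cox_mul_pi.
by apply/eqP/cox_piP; apply: cox_cong_revr.
Qed.

HB.instance Definition _ := isGroup.Build coxGroup
  cox_mulA cox_mul1 cox_mulr1 cox_mulV cox_mulVr.

Local Open Scope group_scope.

Definition cox_gen (i : I) : coxGroup := pi [:: i].

Definition word_prod s : coxGroup := \prod_(i <- s) cox_gen i.

Lemma word_prodE s : word_prod s = pi s.
Proof.
elim: s => [|i s IHs]; first by rewrite /word_prod big_nil.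
by rewrite /word_prod big_cons -/(word_prod s) IHs [LHS]cox_mul_pi.
Qed.

Lemma word_prodP s t : word_prod s = word_prod t <-> cox_cong s t.
Proof. by rewrite !word_prodE; split=> [/eqP/cox_piP|/cox_piP/eqP]. Qed.

Lemma ex_word_size (w : coxGroup) :
  exists k, `[< exists s, word_prod s = w /\ size s = k >].
Proof.
exists (size (repr w)); apply/asboolP; exists (repr w).
by rewrite word_prodE reprK.
Qed.

Definition cox_length (w : coxGroup) : nat := ex_minn (ex_word_size w).

Definition reduced_expr s (w : coxGroup) : Prop :=
  word_prod s = w /\ size s = cox_length w.

Definition commutation_move s t : Prop :=
  exists u v i j, [/\ commute (cox_gen i) (cox_gen j),
    s = u ++ [:: i; j] ++ v & t = u ++ [:: j; i] ++ v].

Definition fully_commutative (w : coxGroup) : Prop :=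
  forall s t, reduced_expr s w -> reduced_expr t w ->
  clos_refl_trans (seq I) commutation_move s t.

Definition cyclically_fully_commutative (w : coxGroup) : Prop :=
  forall s, reduced_expr s w -> forall j,
  exists w', fully_commutative w' /\ reduced_expr (rot j s) w'.

Definition CFC_of_length (k : nat) : set coxGroup :=
  [set w | cyclically_fully_commutative w /\ cox_length w = k]%classic.

(* So [fset_set] below does not fall back on its default value. *)
Lemma finite_CFC_of_length k : finite_set (CFC_of_length k).
Proof.
apply: (@sub_finite_set _ _ [set word_prod (val t) | t in [set: k.-tuple I]]%classic).
  move=> w [_]; rewrite /cox_length; case: ex_minnP => m /asboolP[s [<- <-]] _ <-.
  by exists (in_tuple s).
by apply: finite_image; apply: finite_finset.
Qed.

Definition CFC_series : fps int :=
  FPS (fun k => Posz #|` fset_set (CFC_of_length k)|).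

End CoxeterGroup.

Definition cycle_adj n (i j : 'I_n) : bool :=
  (j == i.+1 %[mod n]) || (i == j.+1 %[mod n]).

Definition affineA_m n (i j : 'I_n) : nat :=
  if i == j then 1 else if cycle_adj i j then 3 else 2.

Fact affineA_m_diag n (i : 'I_n) : affineA_m i i = 1.
Proof. by rewrite /affineA_m eqxx. Qed.
Fact affineA_m_sym n (i j : 'I_n) : affineA_m i j = affineA_m j i.
Proof. by rewrite /affineA_m /cycle_adj eq_sym orbC. Qed.
Fact affineA_m_neq1 n (i j : 'I_n) : i != j -> affineA_m i j != 1.
Proof. by rewrite /affineA_m => /negbTE ->; case: ifP. Qed.

(* For [n <= 2] the n-cycle degenerates and this is not an affine group. *)
Definition affineA n : coxeterMatrix 'I_n :=
  CoxeterMatrix (@affineA_m_diag n) (@affineA_m_sym n) (@affineA_m_neq1 n).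

Definition periodic_from (T : Type) (a : nat -> T) (N L : nat) : Prop :=
  forall k, (L <= k)%N -> a (k + N)%N = a k.

Definition eventual_period (T : Type) (a : nat -> T) (N : nat) : Prop :=
  (0 < N)%N /\ exists L, periodic_from a N L.

Definition exact_period (T : Type) (a : nat -> T) (N : nat) : Prop :=
  eventual_period a N /\ forall N', eventual_period a N' -> (N <= N')%N.

Definition periodicity_starts_at (T : Type) (a : nat -> T) (N L : nat) : Prop :=
  periodic_from a N L /\ forall L', periodic_from a N L' -> (L <= L')%N.

(* Main.v *)
From HB Require Import structures.
From Stdlib Require Import Relations.
Require Import Defs.
From mathcomp Require Import all_boot all_order all_algebra fingroup perm.
From mathcomp Require Import generic_quotient finmap boolp classical_sets cardinality.
From mathcomp Require Import zify ring.

Set Implicit Arguments.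
Unset Strict Implicit.
Unset Printing Implicit Defensive.

Import GRing.Theory Num.Theory.

(** A word without repeated letters is determined, up to commutation of
    non-adjacent generators, by its support and by the order in which adjacent
    letters of the support occur, that is, by an acyclic orientation of the
    subgraph of the [n]-cycle induced on the support.  The cyclically fully
    commutative elements are the elements of these words, together with the positive
    powers of those with full support.

    One half is a descent on words ([cfc_cyclic_word]).  In a reduced word of a
    fully commutative element two consecutive occurrences of [i] enclose at least
    two neighbours of [i] ([fc_two_neighbours]).  If, in some rotation, one of
    [i - 1] and [i + 1] were missing between two consecutive [i]'s, the other one
    would occur there twice, with no [i] in between, and so on with ever shorter
    intervals.  Hence, once a letter is repeated, adjacent letters alternate
    cyclically all around the cycle and all letters occur equally often.

    The other half is that such words are reduced, fully commutative, and equal in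
    the group only if they are related by commutations.  This is true in every
    Coxeter group for the words whose commutation class contains neither [i i] nor
    [i j i] with [i] and [j] not commuting ([fc_word_unique]).  It follows from the
    exchange property, which is derived from the presentation alone: the parity of
    the multiplicity of a reflection along a word is invariant under the relations
    ([refls_parity]).

    The elements of length [d] are thus counted by labellings of the cycle
    ([card_CFC_of_length]).  Summed with weight ['X] per letter, the labellings give
    the trace of the [n]-th power of a transfer matrix
    ([weight_generating_function]).  Its nonzero eigenvalues are the roots of
    [y^2 - (1 + 2q) y + q].  The two cyclic orientations must be removed, which
    subtracts [2 q^n], so the polynomials satisfy the recurrence with characteristic
    polynomial [(y - q) (y^2 - (1 + 2q) y + q)].  A full support admits
    [2^n - 2] acyclic orientations, and each of them yields one element for each
    positive multiple of [n]; no other length from [n] on occurs. *)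

(** * Words, reflections and the exchange property *)

Section Words.

Variables (I : finType) (M : coxeterMatrix I).
Implicit Types (s t u v x y : seq I) (i j a b : I).
Local Open Scope group_scope.
Local Notation gen := (cox_gen M).
Local Notation wp := (word_prod M).

Lemma word_prod_nil : wp [::] = 1.
Proof. by rewrite /word_prod big_nil. Qed.

Lemma word_prod_cons i s : wp (i :: s) = gen i * wp s.
Proof. by rewrite /word_prod big_cons. Qed.

Lemma word_prod_cat s t : wp (s ++ t) = wp s * wp t.
Proof. by rewrite /word_prod big_cat. Qed.

Lemma cox_genK i : gen i * gen i = 1.
Proof.
have /word_prodP := @cox_cong_sq I M i.
by rewrite !word_prod_cons word_prod_nil mulg1.
Qed.

Lemma cox_genV i : (gen i)^-1 = gen i.
Proof. by apply: (mulgI (gen i)); rewrite mulgV cox_genK. Qed.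

Lemma cox_genKl i (w : coxGroup M) : gen i * (gen i * w) = w.
Proof. by rewrite mulgA cox_genK mul1g. Qed.

Lemma relator_prod i j : wp (relator M i j) = (gen i * gen j) ^+ M i j.
Proof.
rewrite /relator; elim: (M i j) => [|m IHm]; first by rewrite word_prod_nil.
by rewrite /= !word_prod_cons IHm mulgA -expgS.
Qed.

Lemma relator_prod1 i j : (gen i * gen j) ^+ M i j = 1.
Proof.
rewrite -relator_prod -word_prod_nil; apply/word_prodP.
by apply: rst_step; exists [::], [::], i, j; rewrite !cats0.
Qed.

Lemma word_prod_parity s t : wp s = wp t -> odd (size s) = odd (size t).
Proof.
move=> /word_prodP; elim=> {s t} [s t [u [v [i [j [-> ->]]]]]|||] //; last first.
  by move=> s t r _ -> _ ->.
rewrite !size_cat !oddD; suff -> : odd (size (relator M i j)) = false by [].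
by rewrite /relator size_flatten /shape map_nseq sumn_nseq oddM.
Qed.

(** The reflections met along the word: for [s = i_1 ... i_p] these are the
    [i_1 ... i_(k-1) i_k i_(k-1) ... i_1].  Left multiplication by the [k]-th of
    them erases the [k]-th letter. *)
Fixpoint refls s : seq (coxGroup M) :=
  if s is i :: s' then gen i :: [seq gen i * r * gen i | r <- refls s'] else [::].

Lemma refls_cat s t :
  refls (s ++ t) = refls s ++ [seq wp s * r * (wp s)^-1 | r <- refls t].
Proof.
elim: s => [|i s IHs] /=.
  by rewrite -[LHS]map_id; apply: eq_map => r; rewrite word_prod_nil mul1g invg1 mulg1.
rewrite IHs map_cat -map_comp; congr (_ :: _ ++ _); apply: eq_map => r /=.
by rewrite word_prod_cons invgM cox_genV !mulgA.
Qed.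

Lemma count_conj (w r : coxGroup M) (l : seq (coxGroup M)) :
  count_mem r [seq w * z * w^-1 | z <- l] = count_mem (w^-1 * r * w) l.
Proof.
rewrite count_map; apply: eq_count => z /=.
apply/eqP/eqP => [<-|->]; first by rewrite !mulgA mulVg mul1g -mulgA mulVg mulg1.
by rewrite !mulgA mulgV mul1g mulgK.
Qed.

Lemma refls_alternating i j m :
  refls (flatten (nseq m [:: i; j])) =
  [seq (gen i * gen j) ^+ k * gen i | k <- iota 0 (m + m)].
Proof.
elim: m => [|m IHm] //=.
rewrite IHm addnS /= expg0 expg1 mul1g -!map_comp; congr [:: _, _ & _].
rewrite -[2]/(2 + 0)%N iotaDl -map_comp; apply: eq_map => k /=.
set ab := gen i * gen j; transitivity (ab * (ab ^+ k * ab) * gen i).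
  by rewrite /ab !mulgA.
by rewrite -expgSr -expgS.
Qed.

(** The [2m] reflections of the relator [(ij)^m] are the [(ij)^k i], and they
    repeat with period [m] because [(ij)^m = 1]. *)
Lemma refls_relator_even i j r : odd (count_mem r (refls (relator M i j))) = false.
Proof.
rewrite /relator refls_alternating iotaD map_cat count_cat add0n.
rewrite -{2}[M i j]addn0 iotaDl -map_comp.
set l1 := map _ _; set l2 := map _ _; suff -> : l2 = l1 by rewrite addnn odd_double.
by apply: eq_map => k /=; rewrite expgnDr relator_prod1 mul1g.
Qed.

(** How often a reflection occurs depends on the word, but the parity of this
    number depends only on the group element: a relator contributes an even
    number of occurrences and only conjugates the later reflections by [1].
    This replaces the usual action of the group on its roots. *)
Lemma refls_parity s t r :
  wp s = wp t -> odd (count_mem r (refls s)) = odd (count_mem r (refls t)).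
Proof.
move=> /word_prodP; elim=> {s t} [s t [u [v [i [j [-> ->]]]]]|||] //; last first.
  by move=> s t z _ -> _ ->.
rewrite !refls_cat map_cat !count_cat !oddD; congr (_ (+) _).
rewrite (count_conj (wp u)) refls_relator_even addFb relator_prod relator_prod1.
rewrite -map_comp; congr (odd (count_mem r _)); apply: eq_map => z /=.
by rewrite mul1g invg1 mulg1.
Qed.

Lemma mem_refls_deletion r s : r \in refls s ->
  exists x j y, s = x ++ j :: y /\ r * wp s = wp (x ++ y).
Proof.
elim: s r => [|i s IHs] r //=; rewrite inE => /orP[/eqP ->|/mapP[z /IHs]].
  by exists [::], i, s; rewrite word_prod_cons cox_genKl.
move=> [x [j [y [-> e]]]] ->; exists (i :: x), j, y; split=> //=.
by rewrite !word_prod_cons -!mulgA cox_genKl e.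
Qed.

Definition reduced s := forall t, wp t = wp s -> size s <= size t.

Lemma reducedP s : reduced s <-> reduced_expr s (wp s).
Proof.
rewrite /reduced_expr /cox_length; case: ex_minnP => m /asboolP[t [et <-]] min.
split=> [s_red|[_ es] z ez]; last by rewrite es; apply: min; apply/asboolP; exists z.
split=> //; apply/eqP; rewrite eqn_leq s_red //.
by apply: min; apply/asboolP; exists s.
Qed.

Lemma reduced_expr_reduced s (w : coxGroup M) : reduced_expr s w -> reduced s.
Proof. by move=> [<- e]; apply/reducedP. Qed.

Lemma ex_reduced (w : coxGroup M) : exists s, reduced_expr s w.
Proof.
have : exists s, wp s = w by exists (repr w); rewrite word_prodE reprK.
rewrite /reduced_expr /cox_length; case: ex_minnP => m /asboolP[t [et <-]] _ _.
by exists t.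
Qed.

Lemma reduced_same_size s t : reduced s -> wp t = wp s -> size t <= size s -> reduced t.
Proof. by move=> sR e le z ez; apply: leq_trans le _; apply: sR; rewrite ez. Qed.

(** [b] occurs once, hence an odd number of times, among the reflections of the
    reduced word [b :: u]; so it occurs among those of every other word [s] for
    the same element, where multiplying by it erases a letter. *)
Lemma exchange_property b u s : reduced (b :: u) -> wp s = wp (b :: u) ->
  exists x j y, s = x ++ j :: y /\ wp s = wp (b :: x ++ y).
Proof.
move=> bu_red e; have b_u : gen b \notin refls u.
  apply/negP => /mem_refls_deletion[x [j [y [eu]]]].
  rewrite -word_prod_cons => /esym/bu_red.
  by rewrite eu /= !size_cat /= addnS ltnNge leqnSn.
have b_s : gen b \in refls s.
  rewrite -has_pred1 has_count lt0n; apply/eqP => c0.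
  have := refls_parity (gen b) e; rewrite c0 /= eqxx add1n /=.
  under eq_map => z do rewrite -[X in _ * X]cox_genV.
  rewrite (count_conj (gen b)).
  by rewrite mulVg mul1g (count_memPn b_u).
have [x [j [y [es H]]]] := mem_refls_deletion b_s.
by exists x, j, y; split=> //; rewrite word_prod_cons -H cox_genKl.
Qed.

End Words.

(** * Fully commutative words *)

Section FullyCommutativeWords.

Variables (I : finType) (M : coxeterMatrix I).
Implicit Types (s t u v x y : seq I) (i j a b : I).
Local Open Scope group_scope.
Local Notation gen := (cox_gen M).
Local Notation wp := (word_prod M).
Local Notation "s ~c t" := (clos_refl_trans (seq I) (commutation_move M) s t)
  (at level 70).

Lemma comm_equiv_sym s t : s ~c t -> t ~c s.
Proof.
elim=> {s t} [s t [u [v [i [j [cij -> ->]]]]]|s|s t z _ ts _ zt].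
- by apply: rt_step; exists u, v, j, i; split=> //; apply: commute_sym.
- exact: rt_refl.
- exact: rt_trans zt ts.
Qed.

Lemma comm_equiv_cat u v s t : s ~c t -> u ++ s ++ v ~c u ++ t ++ v.
Proof.
elim=> {s t} [s t [u' [v' [i [j [cij -> ->]]]]]|s|s t z _ ts _ zt].
- by apply: rt_step; exists (u ++ u'), (v' ++ v), i, j; rewrite -!catA.
- exact: rt_refl.
- exact: rt_trans ts zt.
Qed.

Lemma comm_equiv_cons i s t : s ~c t -> i :: s ~c i :: t.
Proof. by move/(@comm_equiv_cat [:: i] [::]); rewrite !cats0. Qed.

Lemma comm_equiv_swap i j s : commute (gen i) (gen j) -> i :: j :: s ~c j :: i :: s.
Proof. by move=> c; apply: rt_step; exists [::], s, i, j. Qed.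

Lemma comm_equiv_move_front i u v :
  (forall j, j \in u -> commute (gen i) (gen j)) -> u ++ i :: v ~c i :: u ++ v.
Proof.
elim: u => [|j u IHu] cu; first exact: rt_refl.
apply: rt_trans (comm_equiv_cons j (IHu _)) _.
  by move=> k ku; apply: cu; rewrite inE ku orbT.
by apply: comm_equiv_swap; apply/commute_sym/cu; rewrite mem_head.
Qed.

Lemma comm_equiv_perm s t : s ~c t -> perm_eq s t.
Proof.
elim=> {s t} [s t [u [v [i [j [cij -> ->]]]]]|s|s t z _ ts _ zt] //.
  by rewrite perm_cat2l (perm_catCA [:: i] [:: j] v).
exact: perm_trans zt.
Qed.

Lemma comm_equiv_size s t : s ~c t -> size s = size t.
Proof. by move/comm_equiv_perm/perm_size. Qed.

Lemma comm_equiv_prod s t : s ~c t -> wp s = wp t.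
Proof.
elim=> {s t} [s t [u [v [i [j [cij -> ->]]]]]|s|s t z _ ts _ zt] //; last by rewrite ts.
by rewrite !word_prod_cat !word_prod_cons !mulgA -(mulgA _ (gen i)) cij !mulgA.
Qed.

Lemma comm_equiv_filter (P : pred I) s t :
  (forall i j, P i -> P j -> commute (gen i) (gen j) -> i = j) ->
  s ~c t -> filter P s = filter P t.
Proof.
move=> PC; elim=> {s t} [s t [u [v [i [j [cij -> ->]]]]]|s|s t z _ ts _ zt] //; last by rewrite ts.
rewrite !filter_cat /=; case Pi: (P i) => //; case Pj: (P j) => //.
by rewrite (PC i j).
Qed.

(** The local shape of a reduced word of a fully commutative element: no square
    and no half of a braid relation comes up in its commutation class. *)
Definition fc_word s : Prop := forall t, s ~c t ->
  (forall u v i, t <> u ++ [:: i, i & v]) /\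
  (forall u v i j, ~ commute (gen i) (gen j) -> t <> u ++ [:: i, j, i & v]).

Lemma fc_word_equiv s t : s ~c t -> fc_word s -> fc_word t.
Proof. by move=> st sF z tz; apply: sF; apply: rt_trans st tz. Qed.

Lemma fc_word_behead i s : fc_word (i :: s) -> fc_word s.
Proof.
move=> sF t /(comm_equiv_cons i)/sF[F1 F2].
split=> [u v j e|u v j k jk e]; first by apply: (F1 (i :: u) v j); rewrite e.
by apply: (F2 (i :: u) v j k jk); rewrite e.
Qed.

Hypothesis gen_inj : injective gen.

(** Only the exchange property enters.  By induction [s] is reduced, since a
    shorter word for [a :: s] would let [s] begin with [a] up to commutation.  If
    [t] begins with [b], distinct from [a], two exchanges show that the element
    also has a word [a :: b :: v] when [a] and [b] commute, and otherwise a word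
    [a :: b :: a :: v]; by induction the latter lies in the class of [a :: s],
    which [fc_word] forbids. *)
Theorem fc_word_unique s t :
  fc_word s -> wp t = wp s -> size t <= size s -> s ~c t.
Proof.
have [m] := ubnP (size s); elim: m s t => // m IHm [|a s] t /=.
  by move=> _ _ _; rewrite leqn0 => /nilP->; apply: rt_refl.
rewrite ltnS => sm asF et; have sF := fc_word_behead asF.
have cancel_a z u : wp (a :: u) = wp (a :: z) -> wp u = wp z.
  by rewrite !word_prod_cons => /mulgI.
(* [s] cannot begin with [a] up to commutation. *)
have no_aa z : s ~c a :: z -> False.
  by move=> /(comm_equiv_cons a)/asF[F1 _]; apply: (F1 [::] z a).
have as_red : reduced M (a :: s).
  move=> z ez; rewrite leqNgt; apply/negP; rewrite /= ltnS => le_zs.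
  have /(no_aa z) [] // : s ~c a :: z.
  apply: IHm => //; first by rewrite word_prod_cons ez word_prod_cons cox_genKl.
  rewrite /= ltn_neqAle le_zs andbT; apply/eqP => ezs.
  by have := word_prod_parity ez; rewrite /= ezs; case: odd.
move=> le_ts; have t_red := reduced_same_size as_red et le_ts.
have {le_ts} : size t = (size s).+1 by apply/anti_leq; rewrite le_ts as_red.
case: t et t_red => // b t et bt_red [ts].
have [eab|/eqP neq_ab] := eqVneq a b.
  by subst b; apply: comm_equiv_cons; apply: IHm; rewrite ?ts //; apply: cancel_a.
have [x [j [y [es eb]]]] := exchange_property bt_red (esym et).
case: x es eb => [[_ <-]|c x [<- es]].
  by rewrite !word_prod_cons => /mulIg/gen_inj.
(* Here [a :: s] equals [b :: a :: v] in the group. *)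
rewrite /= => eba; set v := x ++ y in eba.
have sv : size s = (size v).+1 by rewrite es !size_cat addnS.
have [cab|ncab] := pselect (commute (gen a) (gen b)).
  have sbv : s ~c b :: v.
    apply: (IHm _ _ sm sF); last by rewrite sv.
    apply: cancel_a.
    by rewrite eba !word_prod_cons !mulgA cab.
  have asbv : a :: s ~c b :: a :: v.
    by apply: rt_trans (comm_equiv_cons a sbv) (comm_equiv_swap _ cab).
  have avF := fc_word_behead (fc_word_equiv asbv asF).
  apply: rt_trans asbv (comm_equiv_cons b _).
  apply: IHm => //=; rewrite -?sv ?ts //.
  by move: et; rewrite eba !(word_prod_cons _ b) => /mulgI.
(* Exchanging [a] into [b :: a :: v] must erase a letter of [v]. *)
have [z [j' [y' [ev ea]]]] := exchange_property as_red (esym eba).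
case: z ev ea => [[_ <-]|d [|d' z] [<-]].
- by rewrite !word_prod_cons => /mulIg/gen_inj/esym.
- move=> [_ <-]; rewrite !word_prod_cons !mulgA => /mulIg/esym cab.
  by case: ncab.
move=> [<- ev]; rewrite /= => ea; rewrite ea in eba.
have : s ~c b :: a :: (z ++ y').
  apply: (IHm _ _ sm sF); last by rewrite /= sv ev !size_cat addnS.
  exact/cancel_a/esym.
move=> /(comm_equiv_cons a)/asF[_ F2].
by case: (F2 [::] (z ++ y') a b ncab).
Qed.

Lemma fc_word_reduced s : fc_word s -> reduced M s.
Proof.
move=> sF t et; case: (leqP (size t) (size s)) => [le_ts|/ltnW //].
by rewrite (comm_equiv_size (fc_word_unique sF et le_ts)).
Qed.

Lemma fc_word_comm_reduced s t : fc_word s -> reduced_expr t (wp s) -> s ~c t.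
Proof.
move=> sF [et st]; apply: fc_word_unique => //.
by rewrite st; have /reducedP[_ <-] := fc_word_reduced sF.
Qed.

Lemma fc_word_fully_commutative s : fc_word s -> fully_commutative (wp s).
Proof.
move=> sF t z /(fc_word_comm_reduced sF) st /(fc_word_comm_reduced sF) sz.
exact: rt_trans (comm_equiv_sym st) sz.
Qed.

End FullyCommutativeWords.

Lemma has_split (T : Type) (P : pred T) (s : seq T) : has P s ->
  exists s1 a s2, [/\ s = s1 ++ a :: s2, P a & ~~ has P s1].
Proof.
elim: s => // b s IHs /=; case Pb: (P b) => /=; first by exists [::], b, s.
move=> /IHs[s1 [a [s2 [-> Pa P1]]]]; by exists (b :: s1), a, s2; rewrite /= Pb.
Qed.

Section Necessity.

Variables (I : finType) (M : coxeterMatrix I) (adj : rel I).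
Local Open Scope group_scope.
Local Notation gen := (cox_gen M).
Local Notation wp := (word_prod M).
Local Notation "s ~c t" := (clos_refl_trans (seq I) (commutation_move M) s t)
  (at level 70).

Hypothesis adj_irr : irreflexive adj.
Hypothesis adj_braid : forall i j, adj i j ->
  gen i * gen j * gen i = gen j * gen i * gen j.
Hypothesis nadj_commute : forall i j, ~~ adj i j -> commute (gen i) (gen j).

(** With no neighbour between them the two [i]'s would cancel; with exactly one,
    [j], they could be gathered into [i j i] and replaced by [j i j], a reduced
    word of the same element with fewer [i]'s, which commutations cannot
    produce. *)
Lemma fc_two_neighbours (w : coxGroup M) p i u q :
  fully_commutative w -> reduced_expr (p ++ i :: u ++ i :: q) w -> i \notin u ->
  1 < count (adj i) u.
Proof.
move=> wF rw iu; have r_red := reduced_expr_reduced rw.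
have nadj_u v : ~~ has (adj i) v -> forall j, j \in v -> commute (gen i) (gen j).
  by move=> /hasPn iv j /iv/nadj_commute.
case: (boolP (has (adj i) u)) => [/has_split[u1 [j [u2 [eu ij u1i]]]]|ui]; last first.
  have := comm_equiv_cat (p ++ [:: i]) [::] (comm_equiv_move_front q (nadj_u _ ui)).
  rewrite !cats0 -!catA => /comm_equiv_prod e.
  have /r_red : wp (p ++ u ++ q) = wp (p ++ i :: u ++ i :: q).
    by rewrite e /= !word_prod_cat !word_prod_cons cox_genKl -word_prod_cat.
  by rewrite !size_cat /= size_cat /= !addnS ltnNge leqnSn.
rewrite eu count_cat /= ij addnA [_ + 1]addnC -addnA ltnS addn_gt0 -!has_count (negbTE u1i) /=.
apply: contraT => u2i; have [ew sw] := rw.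
pose z := p ++ u1 ++ [:: j, i, j & u2 ++ q].
have rz : wp z = wp (p ++ i :: u ++ i :: q) /\ size z = size (p ++ i :: u ++ i :: q).
  split; last first.
    by rewrite /z eu -catA !size_cat /= !size_cat /= ?size_cat /= !addnS.
  have c1 := comm_equiv_prod (comm_equiv_move_front (j :: u2 ++ i :: q) (nadj_u _ u1i)).
  have c2 := comm_equiv_prod (comm_equiv_move_front q (nadj_u _ u2i)).
  rewrite /z eu -catA /= !(word_prod_cat _ p) -c1; congr (_ * _).
  rewrite !(word_prod_cat _ u1) !word_prod_cons c2 word_prod_cons.
  by congr (_ * _); rewrite !mulgA (adj_braid ij).
have : reduced_expr z w by case: rz => [e1 e2]; split; rewrite ?e1 ?e2.
move=> /(wF _ _ rw)/comm_equiv_perm/seq.permP/(_ (pred1 i)).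
have neq_ji : (j == i) = false by apply: contraTF ij => /eqP->; rewrite adj_irr.
move: iu; rewrite /z eu mem_cat inE !negb_or => /and3P[iu1 _ iu2].
rewrite !count_cat /= !count_cat /= eqxx neq_ji ?count_cat.
rewrite (count_memPn iu1) (count_memPn iu2) => /addnI.
by rewrite !add0n !add1n => -[/eqP]; rewrite gtn_eqF.
Qed.

End Necessity.

(** * Generators of the affine group *)

(** For involutions the relation of order three is the braid relation. *)
Lemma braid_order3 (G : groupType) (a b : G) : (a * a = 1)%g -> (b * b = 1)%g ->
  ((a * b) ^+ 3 == 1)%g = (a * b * a == b * a * b)%g.
Proof.
move=> /mulg1_eq aV /mulg1_eq bV.
have -> : ((a * b) ^+ 3 = a * b * a * (b * a * b))%g.
  by rewrite !expgS expg0 mulg1 !mulgA.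
by rewrite mulg_eq1 !invgM aV bV !mulgA.
Qed.

Section AffineGenerators.

Variable k : nat.
Local Notation n := k.+3.
Implicit Types (i j : 'I_n) (s t : seq 'I_n).
Local Open Scope ring_scope.
Local Notation M := (affineA n).
Local Notation gen := (cox_gen M).

Definition adj i j := (j == i + 1) || (i == j + 1).

Lemma cycle_adjE i j : cycle_adj i j = adj i j.
Proof.
suff succE (a b : 'I_n) : (a == b.+1 %[mod n])%N = (a == b + 1) by rewrite /cycle_adj !succE.
by rewrite -val_eqE /= (modn_small (ltn_ord a)) modnDmr addn1.
Qed.

Lemma succ_neq i : (i + 1 == i) = false.
Proof. by rewrite -subr_eq0 addrAC subrr add0r oner_eq0. Qed.

Lemma succ2_neq i : (i + 1 + 1 == i) = false.
Proof. by rewrite -addrA -subr_eq0 addrAC subrr add0r. Qed.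

Lemma adj_irr : irreflexive adj.
Proof. by move=> i; rewrite /adj eq_sym succ_neq. Qed.

Lemma affine_mE i j : M i j = if i == j then 1%N else if adj i j then 3 else 2.
Proof. by rewrite /= /affineA_m cycle_adjE. Qed.

Lemma gen_braid i j : adj i j ->
  (gen i * gen j * gen i = gen j * gen i * gen j)%g.
Proof.
move=> ij; have /eqP := relator_prod1 M i j; rewrite affine_mE ij.
case: (i =P j) ij => [->|_ _]; first by rewrite adj_irr.
by rewrite braid_order3 ?cox_genK // => /eqP.
Qed.

Lemma nadj_commute i j : ~~ adj i j -> commute (gen i) (gen j).
Proof.
move=> ij; have := relator_prod1 M i j; rewrite affine_mE (negbTE ij).
case: eqP => [-> _ //|_]; rewrite expg2 => e; apply: (mulIg (gen i * gen j)%g).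
by rewrite e -mulgA cox_genKl cox_genK.
Qed.

Local Notation tr i := (tperm i (i + 1)).

Lemma tr_nadj_commute i j : i != j -> ~~ adj i j -> commute (tr i) (tr j).
Proof.
move=> nij; rewrite /adj negb_or => /andP[ij ji].
rewrite /commute [RHS]conjgC tpermJ !tpermD //.
- by rewrite (inj_eq (addIr 1)).
- by rewrite eq_sym.
Qed.

Lemma tr_braid i : (tr i ^ tr (i + 1) = tr (i + 1) ^ (tr i)%g)%g.
Proof.
rewrite tpermJ tpermL tpermD ?succ_neq ?succ2_neq //.
by rewrite tpermJ tpermR tpermD // eq_sym ?succ_neq ?succ2_neq.
Qed.

(** The projection of the affine group to the symmetric group, which sends [s_i]
    to the transposition of [i] and [i + 1] modulo [n].  It is only there to tell
    generators apart and to see which of them commute. *)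
Definition word_perm s : {perm 'I_n} := (\prod_(i <- s) tr i)%g.

Lemma word_perm_cong s t : cox_cong M s t -> word_perm s = word_perm t.
Proof.
elim=> {s t} [s t [u [v [i [j [-> ->]]]]]|s|s t _ ->|s t r _ -> _ ->] //.
rewrite /word_perm !big_cat /= -[RHS]mulg1 -mulgA; congr (_ * _)%g.
rewrite mulg1 -[RHS]mul1g; congr (_ * _)%g.
have -> : (\prod_(i <- relator M i j) tr i = (tr i * tr j) ^+ M i j)%g.
  rewrite /relator; elim: (M i j) => [|m IHm] /=; first by rewrite big_nil.
  by rewrite !big_cons IHm mulgA -expgS.
have braid (a : 'I_n) : (tr a * tr (a + 1) * tr a = tr (a + 1) * tr a * tr (a + 1))%g.
  by have := tr_braid a; rewrite !conjgE !tpermV !mulgA.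
rewrite affine_mE; case: eqP => [->|/eqP nij]; first by rewrite expg1 tperm2.
case: ifP => [/orP[]/eqP->|/negbT ij].
- by apply/eqP; rewrite braid_order3 ?tperm2 // braid.
- by apply/eqP; rewrite braid_order3 ?tperm2 // braid.
by rewrite expgMn ?expg2 ?tperm2 ?mulg1 //; apply: tr_nadj_commute.
Qed.

Lemma gen_perm i j : gen i = gen j -> tr i = tr j.
Proof.
have genE a : gen a = word_prod M [:: a] by rewrite word_prodE.
by rewrite !genE => /word_prodP/word_perm_cong; rewrite /word_perm !big_seq1.
Qed.

Lemma gen_inj : injective gen.
Proof.
move=> i j /gen_perm/permP e; apply/eqP; apply: contraT => nij.
have := e i; rewrite tpermL.
case: tpermP => [eij _|ei /eqP|_ _ /eqP]; last by rewrite succ_neq.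
  by rewrite eij eqxx in nij.
by rewrite ei succ2_neq.
Qed.

Lemma commute_nadj i j : commute (gen i) (gen j) -> ~~ adj i j.
Proof.
have genE a b : (gen a * gen b)%g = word_prod M [:: a; b].
  by rewrite !word_prod_cons word_prod_nil mulg1.
rewrite /commute !genE => /word_prodP/word_perm_cong.
rewrite /word_perm !big_cons !big_nil !mulg1 => e.
suff nc (a : 'I_n) : ~ commute (tr a) (tr (a + 1)).
  by apply/negP => /orP[]/eqP ej; [apply: (nc i)|apply: (nc j)]; move: e; rewrite ej.
move=> /commgP/conjg_fixP/permP/(_ a).
rewrite tpermJ [X in tperm _ X _]tpermL [X in tperm X _ _]tpermD ?succ2_neq ?succ_neq //.
rewrite !tpermL => /eqP.
by rewrite succ_neq.
Qed.

End AffineGenerators.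

(** * Cyclic alternation *)

Notation neq_rel := [rel x y | x != y].

Section SeqExtra.
Variable T : eqType.
Implicit Types (s g p : seq T) (P : pred T) (e : rel T) (a b c x : T).

Lemma count2_split c s : 1 < count_mem c s ->
  exists s1 s2 s3, s = s1 ++ c :: s2 ++ c :: s3 /\ c \notin s2.
Proof.
move=> c2; have : has (pred1 c) s by rewrite has_count ltnW.
move=> /has_split[s1 [x [z [es /eqP ex c1]]]]; subst x.
have : has (pred1 c) z.
  move: c2; rewrite es count_cat /= eqxx (count_memPn _) -?has_pred1 //.
  by rewrite ltnS -has_count.
move=> /has_split[s2 [x [s3 [ez /eqP ex c3]]]]; subst x.
by exists s1, s2, s3; rewrite es ez -has_pred1.
Qed.

Lemma filter_cat_split P s g1 g2 : filter P s = g1 ++ g2 ->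
  exists s1 s2, [/\ s = s1 ++ s2, filter P s1 = g1 & filter P s2 = g2].
Proof.
elim: s g1 => [|a s IHs] g1 /=; first by case: g1 => //= <-; exists [::], [::].
case Pa: (P a); last first.
  by move=> /IHs[s1 [s2 [-> e1 e2]]]; exists (a :: s1), s2; rewrite /= Pa.
case: g1 => [|b g1] /=; first by move=> e; exists [::], (a :: s); rewrite /= Pa.
by move=> [<-] /IHs[s1 [s2 [-> e1 e2]]]; exists (a :: s1), s2; rewrite /= Pa e1.
Qed.

Lemma filter_cons_split P s x g : filter P s = x :: g ->
  exists u v, [/\ s = u ++ x :: v, ~~ has P u & filter P v = g].
Proof.
elim: s => //= a s IHs; case Pa: (P a); first by case=> <- <-; exists [::], s.
by move=> /IHs[u [v [-> Pu <-]]]; exists (a :: u), v; rewrite /= Pa.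
Qed.

Lemma path_violation e x p : ~~ path e x p ->
  exists p1 y p2, p = p1 ++ y :: p2 /\ ~~ e (last x p1) y.
Proof.
elim: p x => //= y p IHp x; rewrite negb_and; case exy: (e x y) => /=.
  by move=> /IHp[p1 [z [p2 [-> ez]]]]; exists (y :: p1), z, p2.
by exists [::], y, p; rewrite /= exy.
Qed.

(** A violation of the relation may sit across the ends of the list; rotating
    brings it to the front. *)
Lemma cycle_violation e g : 1 < size g -> ~~ path.cycle e g ->
  exists g1 x y g2, [/\ (g = g1 ++ g2 /\ exists g3, g2 ++ g1 = [:: x, y & g3]) & ~~ e x y].
Proof.
case: g => //= c p p0 /path_violation[p1 [y [p2 [ep exy]]]].
case/lastP: p2 ep => [|p2 z].
  rewrite cats1 => /rcons_inj[e1 e2]; subst p1 y.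
  case/lastP: p p0 exy => [//|p z] _; rewrite last_rcons => ezc.
  by exists (c :: p), z, c, [:: z]; split=> //; split; [rewrite cats1|exists p].
rewrite -rcons_cons -rcons_cat => /rcons_inj[-> _].
exists (belast c p1), (last c p1), y, (last c p1 :: y :: p2); split=> //; split.
  by rewrite -(cat_rcons (last c p1)) -lastI.
by exists (p2 ++ belast c p1).
Qed.

Lemma cycle_neq_no_double g1 g2 x : path.cycle neq_rel (g1 ++ [:: x, x & g2]) = false.
Proof. by rewrite -(rot_cycle (size g1)) rot_size_cat /= eqxx. Qed.

Lemma alternating_path a b g : a != b -> all (pred2 a b) g ->
  path neq_rel a (rcons g a) -> exists m, a :: g = flatten (nseq m [:: a; b]).
Proof.
move=> ab; have [m] := ubnP (size g); elim: m g => // m IHm [|x [|y g]] /=.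
- by rewrite eqxx.
- move=> _ /andP[/orP[]/eqP-> _]; first by rewrite eqxx.
  by exists 1.
move=> sg /and3P[xab yab gab] /and3P[ax xy yg].
have ex : x = b by case/orP: xab ax => /eqP-> //; rewrite eqxx.
have ey : y = a by case/orP: yab xy => /eqP-> //; rewrite ex eqxx.
rewrite ey in yg; have [m' e] := IHm g (ltnW sg) gab yg.
by exists m'.+1; rewrite /= -e ex ey.
Qed.

Lemma alternating_form a b g : a != b -> all (pred2 a b) g -> path.cycle neq_rel g ->
  exists m, g = flatten (nseq m [:: a; b]) \/ g = flatten (nseq m [:: b; a]).
Proof.
move=> ab; case: g => [|x g]; first by exists 0; left.
move=> /= /andP[/orP[]/eqP-> gab] xg.
  by have [m ->] := alternating_path ab gab xg; exists m; left.
have gba : all (pred2 b a) g by apply: sub_all gab => z /=; rewrite orbC.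
by rewrite eq_sym in ab; have [m ->] := alternating_path ab gba xg; exists m; right.
Qed.

Lemma cycle_alternating a b m : a != b -> path.cycle neq_rel (flatten (nseq m [:: a; b])).
Proof.
move=> ab; case: m => // m /=; rewrite ab /=.
elim: m => [|m IHm] /=; first by rewrite eq_sym ab.
by rewrite eq_sym ab /=.
Qed.

Lemma count_flatten_nseq P m s : count P (flatten (nseq m s)) = m * count P s.
Proof. by rewrite count_flatten map_nseq sumn_nseq mulnC. Qed.

Lemma filter_flatten_nseq P m s :
  filter P (flatten (nseq m s)) = flatten (nseq m (filter P s)).
Proof. by rewrite filter_flatten map_nseq. Qed.

End SeqExtra.

Section CyclicWords.

Variable k : nat.
Local Notation n := k.+3.
Implicit Types (i j c b : 'I_n) (s t : seq 'I_n).
Local Open Scope ring_scope.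
Local Notation M := (affineA n).
Local Notation gen := (cox_gen M).
Local Notation wp := (word_prod M).
Local Notation "s ~c t" := (clos_refl_trans (seq 'I_n) (commutation_move M) s t)
  (at level 70).

(** Commutations never exchange two adjacent letters, so these projections are
    invariants of the commutation class; [proj_comm_equiv] shows that they
    determine it. *)
Definition proj i s := filter (pred2 i (i + 1)) s.

Definition alternating s := forall i, path.cycle neq_rel (proj i s).

(** These are the reduced words of the cyclically fully commutative elements. *)
Definition cyclic_word s := uniq s \/ alternating s.

Lemma adj_sym i j : adj i j = adj j i.
Proof. by rewrite /adj orbC. Qed.

Lemma adj_two c b : adj c b ->
  exists2 b', adj c b' & forall j, adj c j -> (j == b) || (j == b').
Proof.
rewrite /adj -(inj_eq (addIr (-1)) c) addrK.
move=> /orP[]/eqP <-; [exists (c - 1)|exists (c + 1)]; rewrite ?subrK ?eqxx ?orbT // => j.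
  by rewrite -(inj_eq (addIr (-1)) c) addrK (eq_sym _ j).
by rewrite -(inj_eq (addIr (-1)) c) addrK (eq_sym _ j) orbC.
Qed.

Section Cfc.

Variables (w : coxGroup M) (s : seq 'I_n).
Hypotheses (wC : cyclically_fully_commutative w) (sw : reduced_expr s w).

Lemma cfc_neighbours e p c u q :
  rot e s = p ++ c :: u ++ c :: q -> c \notin u -> (1 < count (adj c) u)%N.
Proof.
move=> es cu; have [w' [w'F]] := wC sw e; rewrite es => r.
exact: (fc_two_neighbours (@adj_irr k) (@gen_braid k) (@nadj_commute k) w'F r cu).
Qed.

(** Infinite descent: if one neighbour of [c] were absent between two consecutive
    [c]'s, the other one, [b'], would occur there twice; two consecutive
    occurrences of [b'] would then enclose no [c], and would be closer. *)
Lemma cfc_both_neighbours e p c u q b :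
  rot e s = p ++ c :: u ++ c :: q -> c \notin u -> adj c b -> b \in u.
Proof.
have [m] := ubnP (size u); elim: m p c u q b => // m IHm p c u q b um es cu cb.
apply: contraT => bu; have := cfc_neighbours es cu; have [b' cb' adj_cE] := adj_two cb.
have -> : count (adj c) u = count_mem b' u.
  apply: eq_in_count => x xu /=; apply/idP/eqP => [/adj_cE|-> //].
  by case/orP => /eqP // xb; rewrite -xb xu in bu.
case/count2_split => u1 [u2 [u3 [eu b'u2]]].
have := IHm (p ++ c :: u1) b' u2 (u3 ++ c :: q) c.
rewrite (negbTE (_ : c \notin u2)); last first.
  by apply: contra cu; rewrite eu !(mem_cat, inE) => ->; rewrite !orbT.
apply=> //; last by rewrite adj_sym.
  rewrite ltnS in um; apply: leq_trans um.
  by rewrite eu size_cat /= size_cat /= addnS ltnS addnCA leq_addr.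
by rewrite es eu -!catA /= -catA.
Qed.

(** An equal pair [x x] in a rotation of the projection would come from two
    consecutive [x]'s in a rotation of [s] with the other letter of the pair missing
    between them. *)
Lemma cfc_cycle_proj i : (1 < size (proj i s))%N -> path.cycle neq_rel (proj i s).
Proof.
move=> s2; apply: contraT => /(cycle_violation s2).
move=> [g1 [x [y [g2 [[eg [g3 eg3]]]]]]] /negPn/eqP exy; subst y.
have [s1 [s2' [es e1 e2]]] := filter_cat_split eg.
have : filter (pred2 i (i + 1)) (rot (size s1) s) = [:: x, x & g3].
  by rewrite es rot_size_cat filter_cat e1 e2.
move=> e; have [u [v [er _ /filter_cons_split[u' [q [ev nu' _]]]]]] := filter_cons_split e.
have xi : (x == i) || (x == i + 1).
  have : x \in filter (pred2 i (i + 1)) (rot (size s1) s) by rewrite e mem_head.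
  by rewrite mem_filter => /andP[].
rewrite ev in er; have u'N z : pred2 i (i + 1) z -> z \in u' = false.
  by move=> Pz; apply: contraNF nu' => zu; apply/hasP; exists z.
have xu' : x \notin u' by rewrite u'N.
have nb := cfc_both_neighbours er xu'.
case/orP: xi => /eqP ex.
  by have := nb (i + 1); rewrite u'N /= ?eqxx ?orbT // ex /adj eqxx => /(_ isT).
by have := nb i; rewrite u'N /= ?eqxx // ex /adj eqxx orbT => /(_ isT).
Qed.

(** If [i] is repeated, the projection to [i] and [i + 1] alternates cyclically,
    so [i + 1] occurs as often as [i]; going round the cycle, every letter is
    repeated. *)
Lemma cfc_cyclic_word : cyclic_word s.
Proof.
have [|sN] := boolP (uniq s); [by left|right].
have [c c2] : exists c, (1 < count_mem c s)%N.
  apply/existsP; apply: contraR sN; rewrite negb_exists => /forallP c1.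
  apply: count_mem_uniq => c; have := c1 c; rewrite -leqNgt -has_pred1 has_count.
  by case: (count_mem c s) => [|[]].
have step i : (1 < count_mem i s)%N ->
    path.cycle neq_rel (proj i s) /\ (1 < count_mem (i + 1)%R s)%N.
  have ci j : pred2 i (i + 1) j -> count_mem j (proj i s) = count_mem j s.
    move=> Pj; rewrite count_filter; apply: eq_count => z /=.
    by case: eqP => // ->; apply/esym.
  move=> i2; have c_i : path.cycle neq_rel (proj i s).
    apply: cfc_cycle_proj; apply: leq_trans i2 _; rewrite -ci /= ?eqxx //.
    exact: count_size.
  split=> //; have nii : i != i + 1 by rewrite eq_sym succ_neq.
  have [m] := alternating_form nii (filter_all _ _) c_i.
  rewrite -ci /= ?eqxx ?orbT // -/(proj i s).
  rewrite -(ci i) /= ?eqxx // in i2.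
  by case=> e; move: i2; rewrite e !count_flatten_nseq /= !eqxx (negbTE nii) eq_sym (negbTE nii).
have all2 (m : nat) : (1 < count_mem (c + m%:R)%R s)%N.
  by elim: m => [|m /step[_]]; rewrite ?addr0 // -addrA -mulrSr.
move=> i; have [] // := step i.
by have := all2 (val (i - c)); rewrite natr_Zp addrC subrK.
Qed.

End Cfc.

Lemma proj_equiv s t i : s ~c t -> proj i s = proj i t.
Proof.
apply: comm_equiv_filter => a b /= /orP[]/eqP-> /orP[]/eqP-> //.
  by move=> /commute_nadj; rewrite /adj eqxx.
by move=> /commute_nadj; rewrite /adj eqxx orbT.
Qed.

Lemma cyclic_word_equiv s t : s ~c t -> cyclic_word s -> cyclic_word t.
Proof.
move=> st [us|sA]; first by left; rewrite -(perm_uniq (comm_equiv_perm st)).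
by right=> i; rewrite -(proj_equiv i st).
Qed.

Lemma cyclic_word_rot e s : cyclic_word s -> cyclic_word (rot e s).
Proof.
move=> [us|sA]; [by left; rewrite rot_uniq|right=> i].
rewrite /proj /rot filter_cat -(rot_cycle (size (filter (pred2 i (i+1)) (drop e s)))).
rewrite rot_size_cat -filter_cat cat_take_drop; exact: sA.
Qed.

(** A square [i i] survives in the projection to [i] and [i + 1].  A factor
    [i j i] becomes a square in the projection to [i] and the neighbour of [i]
    other than [j]; there is one because the cycle has at least three nodes. *)
Lemma cyclic_word_fc s : cyclic_word s -> fc_word M s.
Proof.
move=> sC t /cyclic_word_equiv/(_ sC) {s sC}.
case=> [ut|tA]; split=> [u v i et|u v i j nij et]; subst t.
- by move: ut; rewrite cat_uniq /= inE eqxx !andbF.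
- by move: ut; rewrite cat_uniq /= !inE eqxx orbT !andbF.
- by have := tA i; rewrite /proj filter_cat /= eqxx cycle_neq_no_double.
have : adj i j by apply/negPn/negP => /nadj_commute.
move=> /orP[]/eqP ej.
  have := tA (i - 1); rewrite /proj filter_cat /= subrK eqxx orbT ej succ_neq orbF.
  by rewrite -subr_eq0 opprB addrA [i + 1 + 1]addrC addrA addrAC addrK cycle_neq_no_double.
have := tA i; rewrite /proj filter_cat /= eqxx.
by rewrite (eq_sym j) ej succ_neq  (eq_sym j) succ2_neq cycle_neq_no_double.
Qed.

(** Cyclic words are closed under commutation and rotation, and each of them is
    a reduced word of a fully commutative element. *)
Theorem cyclic_word_cfc s : cyclic_word s -> cyclically_fully_commutative (wp s).
Proof.
move=> sC t /(fc_word_comm_reduced (@gen_inj k) (cyclic_word_fc sC)) st e.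
have := cyclic_word_fc (cyclic_word_rot e (cyclic_word_equiv st sC)) => rF.
exists (wp (rot e t)); split; first exact: fc_word_fully_commutative (@gen_inj k) _ rF.
by apply/reducedP; apply: fc_word_reduced (@gen_inj k) _ rF.
Qed.

(** The first letter [a] of [s] has no neighbour before its first occurrence in
    [t], as the projections show; so it can be moved to the front of [t]. *)
Lemma proj_comm_equiv s t : (forall i, proj i s = proj i t) -> s ~c t.
Proof.
elim: s t => [|a s IHs] t e.
  case: t e => [|b t /(_ b)]; first by move=> _; apply: rt_refl.
  by rewrite /proj /= eqxx.
have : has (pred1 a) t.
  rewrite has_pred1; have : a \in proj a t by rewrite -e /proj /= eqxx mem_head.
  by rewrite mem_filter => /andP[].
move=> /has_split[u [x [v [et /eqP ex ua]]]]; subst x.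
have u_nadj b : b \in u -> ~~ adj a b.
  move=> bu; have ab : b != a by apply: contraNneq ua => <-; rewrite has_pred1.
  have no_i i : pred2 i (i + 1) a -> pred2 i (i + 1) b -> False.
    move=> ia ib; have := e i; rewrite et /proj filter_cat /=.
    move: (ia) => /= ->.
    have : b \in filter (pred2 i (i + 1)) u by rewrite mem_filter ib.
    case eu: (filter _ u) => [//|x z] _ /= [ax _]; case/negP: ua.
    rewrite has_pred1; have : x \in filter (pred2 i (i + 1)) u by rewrite eu mem_head.
    by rewrite -ax mem_filter => /andP[].
  apply/negP => /orP[]/eqP eb; [apply: (no_i a)|apply: (no_i b)];
    by rewrite /= ?eb eqxx ?orbT.
have tE : t ~c a :: u ++ v.
  by rewrite et; apply: comm_equiv_move_front => b /u_nadj/nadj_commute.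
apply: rt_trans (comm_equiv_sym tE); apply: comm_equiv_cons; apply: IHs => i.
have := e i; rewrite (proj_equiv i tE) /proj /=.
by case: ifP => // _ [].
Qed.

End CyclicWords.

(** * Labellings of the cycle *)

Lemma sum_count_mem (T : finType) (s : seq T) : \sum_(x : T) count_mem x s = size s.
Proof.
elim: s => [|a s IHs] /=; first by rewrite big1.
by rewrite big_split /= IHs (bigD1 a) //= eqxx big1 ?addn0 // => x /negbTE; rewrite eq_sym => ->.
Qed.

Section Labels.

Variable k : nat.
Local Notation n := k.+3.
Implicit Types (i j c b : 'I_n) (s t : seq 'I_n) (m : nat).
Local Open Scope ring_scope.
Local Notation M := (affineA n).
Local Notation "s ~c t" := (clos_refl_trans (seq 'I_n) (commutation_move M) s t)
  (at level 70).

(** Label of a node [i] of the cycle, for a word: [None] if [i] does not occur,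
    [Some true] if [i + 1] occurs and [i] comes before it, and [Some false]
    otherwise.  A labelling thus encodes a support together with an orientation of
    the edges inside it. *)
Definition label := option bool.

Implicit Types (f g : 'I_n -> label).

Definition edge_word f i : seq 'I_n :=
  match f i, f (i + 1) with
  | None, None => [::]
  | None, Some _ => [:: i + 1]
  | Some _, None => [:: i]
  | Some true, Some _ => [:: i; i + 1]
  | Some false, Some _ => [:: i + 1; i]
  end.

(** [s] looks like the [m]-th power of a word without repetition whose support and
    orientation are given by [f]. *)
Definition realizes f m s := forall i, proj i s = flatten (nseq m (edge_word f i)).

(** The value [Some true] claims that the edge from [i] to [i + 1] lies in the
    support. *)
Definition valid f := [forall i, (f i == Some true) ==> (f (i + 1) != None)].
Definition full f := [forall i, f i != None].

(** The two cyclic orientations of the whole cycle, which no word can have. *)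
Definition constant_label f := [exists b : bool, forall i, f i == Some b].

Definition label_of s : 'I_n -> label := fun i =>
  if i \in s then Some ((i + 1 \in s) && (ohead (proj i s) == Some i)) else None.

Lemma mem_proj i j s : pred2 i (i + 1) j -> (j \in proj i s) = (j \in s).
Proof. by move=> Pj; rewrite mem_filter Pj. Qed.

Lemma label_of_valid s : valid (label_of s).
Proof.
apply/forallP => i; apply/implyP; rewrite /label_of.
by case: (i \in s) => //; case: (i + 1 \in s).
Qed.

Lemma realizes_comm_equiv f m s t : realizes f m s -> realizes f m t -> s ~c t.
Proof. by move=> sf tf; apply: proj_comm_equiv => i; rewrite sf tf. Qed.

Lemma count_edge_word f i : count_mem i (edge_word f i) = (f i != None).
Proof.
rewrite /edge_word; have := succ_neq i.
by case: (f i) (f (i + 1)) => [[]|] [[]|] e //=; rewrite ?eqxx ?e.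
Qed.

Lemma realizes_count f m s i : realizes f m s -> count_mem i s = (m * (f i != None))%N.
Proof.
move=> /(_ i) e; rewrite -count_edge_word -count_flatten_nseq -e count_filter.
by apply: eq_count => z /=; case: eqP => // ->.
Qed.

Lemma realizes_mem f m s i : (0 < m)%N -> realizes f m s -> (i \in s) = (f i != None).
Proof.
by move=> m0 sf; rewrite -has_pred1 has_count (realizes_count i sf) muln_gt0 m0 lt0b.
Qed.

Definition weight f := #|[set i | f i != None]|.

Lemma realizes_size f m s : realizes f m s -> size s = (m * weight f)%N.
Proof.
move=> sf; rewrite -sum_count_mem /weight cardsE -sum1_card [in RHS]big_mkcond big_distrr /=.
by apply: eq_bigr => i _; rewrite (realizes_count i sf) unfold_in; case: (_ == _).
Qed.

Lemma realizes_label f m s : (0 < m)%N -> valid f -> realizes f m s -> f =1 label_of s.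
Proof.
move=> m0 /forallP fV sf i; rewrite /label_of !(realizes_mem _ m0 sf) sf.
case: m m0 sf => // m _ sf; rewrite /= /edge_word.
have := fV i; case: (f i) (f (i + 1)) => [[]|] [b|] //= _; rewrite ?eqxx //.
by rewrite /eq_op /= succ_neq.
Qed.

Lemma uniq_realizes s : uniq s -> realizes (label_of s) 1 s.
Proof.
move=> us i; rewrite /= cats0 /edge_word /label_of.
have nii := succ_neq i; rewrite -(@mem_proj i i) /= ?eqxx //.
rewrite -(@mem_proj i (i + 1)) /= ?eqxx ?orbT //.
have : uniq (proj i s) by apply: filter_uniq.
have : all (pred2 i (i + 1)) (proj i s) by apply: filter_all.
case: (proj i s) => [|x [|y [|z g]]] //=; rewrite ?inE.
- by rewrite andbT => /orP[]/eqP-> _; rewrite ?eqxx ?nii ?(eq_sym i) ?nii.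
- rewrite (inj_eq Some_inj) => /and3P[/orP[]/eqP-> /orP[]/eqP-> _];
    by rewrite ?eqxx ?(eq_sym i) ?nii ?eqxx.
by move=> /and4P[/orP[]/eqP-> /orP[]/eqP-> /orP[]/eqP-> _];
  rewrite !eqxx ?orbT ?andbF.
Qed.

Lemma alternating_realizes s : ~~ uniq s -> alternating s ->
  exists m, [/\ (0 < m)%N, full (label_of s) & realizes (label_of s) m s].
Proof.
move=> sN sA.
have nii i : i != i + 1 by rewrite eq_sym succ_neq.
have form i : proj i s = flatten (nseq (count_mem i s) [:: i; i + 1]) \/
              proj i s = flatten (nseq (count_mem i s) [:: i + 1; i]).
  have -> : count_mem i s = count_mem i (proj i s).
    by rewrite count_filter; apply: eq_count => z /=; case: eqP => // ->.
  have [m] := alternating_form (nii i) (filter_all _ _) (sA i).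
  rewrite -/(proj i s) => e; suff -> : count_mem i (proj i s) = m by [].
  by case: e => ->; rewrite count_flatten_nseq /= eqxx (eq_sym _ i) (negbTE (nii i)) ?muln1.
have step i : count_mem (i + 1) s = count_mem i s.
  have -> : count_mem (i + 1) s = count_mem (i + 1) (proj i s).
    by rewrite count_filter; apply: eq_count => z /=; case: eqP => // ->; rewrite orbT.
  by case: (form i) => ->; rewrite count_flatten_nseq /= eqxx (negbTE (nii i)) ?muln1.
have all0 i : count_mem i s = count_mem (0 : 'I_n) s.
  rewrite -[i]natr_Zp; elim: (i : nat) => // d <-.
  by rewrite -[in RHS]step -natr1.
have m0 : (0 < count_mem (0%R : 'I_n) s)%N.
  rewrite lt0n; apply: contra sN => /eqP e0; case: s e0 all0 {sA form step} => // x s' e0 /(_ x).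
  by rewrite e0 /= eqxx.
have mem_s i : i \in s by rewrite -has_pred1 has_count all0.
exists (count_mem (0 : 'I_n) s); split=> //.
  by apply/forallP => i; rewrite /label_of mem_s.
move=> i; rewrite /edge_word /label_of !mem_s /=.
rewrite -(all0 i); case: (form i) => ->; rewrite all0;
  case: (count_mem _ s) m0 => // d _ /=; first by rewrite eqxx.
by rewrite /eq_op /= succ_neq.
Qed.

Lemma cyclic_word_realizes s : cyclic_word s ->
  exists m, [/\ (0 < m)%N, m = 1%N \/ full (label_of s) & realizes (label_of s) m s].
Proof.
have [us _|sN] := boolP (uniq s).
  by exists 1%N; split; [|left|apply: uniq_realizes].
case=> [us|sA]; first by rewrite us in sN.
by have [m [m0 fF sf]] := alternating_realizes sN sA; exists m; split=> //; right.
Qed.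

Lemma realizes_cyclic_word f m s : m = 1%N \/ full f -> realizes f m s -> cyclic_word s.
Proof.
move=> mf sf; case: mf => [em|/forallP fF]; [left|right].
  by apply: count_mem_uniq => i; rewrite (realizes_mem i _ sf) ?(realizes_count i sf) em ?mul1n.
move=> i; rewrite sf /edge_word; have := fF i; have := fF (i + 1).
case: (f i) (f (i + 1)) => [[]|] [b|] //= _ _; apply: cycle_alternating.
  by rewrite eq_sym succ_neq.
by rewrite succ_neq.
Qed.

(** For a constant labelling every letter would have to come after one of its
    neighbours, and the first letter cannot. *)
Lemma realizes_nonconstant f m s : (0 < m)%N -> realizes f m s -> ~~ constant_label f.
Proof.
move=> m0 sf; apply/existsP => -[b /forallP fb].
have := realizes_mem 0 m0 sf; rewrite (eqP (fb 0)).
case: s sf => //= a s sf _; case: m m0 sf => // m _ sf.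
case: b fb => fb.
  have := sf (a - 1); rewrite /proj /edge_word !(eqP (fb _)) /= subrK eqxx orbT.
  by case=> /eqP; rewrite -subr_eq0 opprB addrC subrK oner_eq0.
have := sf a; rewrite /proj /edge_word !(eqP (fb _)) /= eqxx.
by case=> /eqP; rewrite eq_sym succ_neq.
Qed.

Lemma realizes_repeat f m s : realizes f 1 s -> realizes f m (flatten (nseq m s)).
Proof.
by move=> sf i; rewrite /proj filter_flatten_nseq -/(proj i s) sf /= cats0.
Qed.

Section Existence.

Variables (f : 'I_n -> label) (a : 'I_n).
Local Notation pt d := (a + d%:R).

(** The letters [a + 1], ..., [a + d], added one after the other at the end or in
    front according to the orientation of the new edge: an edge is compared only
    with the preceding letter, and all earlier choices are preserved. *)
Fixpoint path_word d : seq 'I_n :=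
  if d is d'.+1 then
    if f (pt d') == Some true then rcons (path_word d') (pt d)
    else pt d :: path_word d'
  else [::].

Lemma mem_path_word d x : (x \in path_word d) = [exists e : 'I_d, x == pt e.+1].
Proof.
elim: d => [|d IHd]; first by apply/esym/existsP => -[[]].
have -> : [exists e : 'I_d.+1, x == pt e.+1] = (x == pt d.+1) || (x \in path_word d).
  rewrite IHd; apply/existsP/orP => [[e]|[|/existsP[e]]].
  - case: (unliftP ord_max e) => [e'|] -> /= xe; last by left.
    by right; apply/existsP; exists e'; move: xe; rewrite /bump leqNgt ltn_ord.
  - by exists ord_max.
  - by exists (widen_ord (leqnSn d) e).
by rewrite /=; case: ifP => _; rewrite ?mem_rcons inE.
Qed.

Lemma pt_inj d e : (d < n)%N -> (e < n)%N -> (pt d == pt e) = (d == e).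
Proof.
move=> dn en; rewrite (inj_eq (addrI a)) -val_eqE /= !Zp_nat /=.
by rewrite !modn_small.
Qed.

Lemma path_word_filter0 (P : pred 'I_n) d :
  (forall e, (e < d)%N -> ~~ P (pt e.+1)) -> filter P (path_word d) = [::].
Proof.
move=> Pd; apply/eqP; rewrite -size_eq0 size_filter -leqn0 leqNgt -has_count.
apply/hasPn => x; rewrite mem_path_word => /existsP[[e ed] /eqP->]; exact: Pd.
Qed.

Lemma path_word_filterS (P : pred 'I_n) d :
  ~~ P (pt d.+1) -> filter P (path_word d.+1) = filter P (path_word d).
Proof.
by move=> /negbTE Pd /=; case: ifP => _; rewrite ?filter_rcons /= Pd.
Qed.

Lemma path_word_last d : (d.+1 < n)%N -> proj (pt d.+1) (path_word d.+1) = [:: pt d.+1].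
Proof.
move=> dn; have e0 : proj (pt d.+1) (path_word d) = [::].
  apply: path_word_filter0 => e ed /=.
  (* [pt d.+2] may be [a] itself, beyond the range of [pt_inj]. *)
  have -> : (pt e.+1 == pt d.+1 + 1) = (pt e == pt d.+1).
    by rewrite mulrSr addrA (inj_eq (addIr 1)).
  by rewrite !pt_inj; lia.
by move: e0; rewrite /proj /= => e0; case: ifP => _; rewrite ?filter_rcons /= eqxx e0.
Qed.

Lemma path_word_edge d e : (d < n)%N -> (0 < e < d)%N ->
  proj (pt e) (path_word d) =
  if f (pt e) == Some true then [:: pt e; pt e + 1] else [:: pt e + 1; pt e].
Proof.
elim: d => [|d IHd] dn /andP[e0]; rewrite ?ltn0 // ltnS leq_eqVlt => /orP[/eqP ed|ed].
  subst e; case: d e0 dn {IHd} => // d _ dn.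
  have := path_word_last (ltnW dn); rewrite /proj /= -addrA -mulrSr.
  by case: (f (pt d.+1) == _) => e; rewrite ?filter_rcons /= eqxx orbT e.
rewrite -IHd ?e0 ?ed ?(ltnW dn) //; apply: path_word_filterS.
by rewrite /= -addrA -mulrSr !pt_inj; lia.
Qed.

Lemma path_word_first d : (d.+1 < n)%N -> proj a (path_word d.+1) = [:: a + 1].
Proof.
elim: d => [|d IHd] dn.
  by rewrite /proj /= mulr1n; case: ifP => _ /=; rewrite eqxx orbT.
rewrite -IHd ?(ltnW dn) //; apply: path_word_filterS.
have := @pt_inj _ 0%N dn isT; have := @pt_inj _ 1%N dn isT.
by rewrite addr0 /= => -> ->.
Qed.

(** The cycle is cut at [a], which is put first: either [a] is outside the support
    and disappears, or it precedes those of its neighbours that occur. *)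
Hypothesis fa : f a = None \/ f a = Some true /\ f (a - 1) != Some true.

Definition label_word := filter (fun x => f x != None) (a :: path_word k.+2).

Lemma label_word_realizes : realizes f 1 label_word.
Proof.
move=> i; rewrite /= cats0 /label_word /proj -filter_predI.
rewrite (eq_filter (a2 := predI (fun x => f x != None) (pred2 i (i + 1)))); last first.
  by move=> x /=; rewrite andbC.
rewrite filter_predI -/(proj i (a :: _)).
suff [b -> fb] : exists2 b : bool,
    proj i (a :: path_word k.+2) = if b then [:: i; i + 1] else [:: i + 1; i] &
    f i != None -> f (i + 1) != None -> b = (f i == Some true).
  move: fb; rewrite /edge_word.
  case: b => /=; case: (f i) (f (i + 1)) => [[]|] [c|] //= fb;
    by have := fb isT isT; rewrite /eq_op.
have [e en ->] : exists2 e, (e < n)%N & i = pt e.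
  by exists (i - a : 'I_n) => //; rewrite natr_Zp addrC subrK.
case: e en => [|e] en.
  exists true.
    by rewrite addr0 /proj /= eqxx -/(proj a _) path_word_first.
  by rewrite addr0; case: fa => [->|[-> _]].
have [ek|ek] := eqVneq e k.+1.
  have e1 : pt e.+1 + 1 = a.
    rewrite -addrA -mulrSr ek (_ : k.+3%:R = 0) ?addr0 //.
    by apply: val_inj; rewrite Zp_nat /= modnn.
  exists false.
    rewrite /proj -cat1s filter_cat -!/(proj _ _) {2}ek path_word_last -?ek //.
    by rewrite /proj /= e1 eqxx orbT ek.
  rewrite e1; case: fa => [->|[-> fa1]] // _ _; apply/esym/negbTE.
  by rewrite -(addrK 1 (pt _)) e1.
exists (f (pt e.+1) == Some true) => //.
have ne2 : (e.+2 < n)%N by lia.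
rewrite -(@path_word_edge k.+2) //.
rewrite /proj /=; have := @pt_inj _ 0%N en isT; have := @pt_inj _ 0%N ne2 isT.
by rewrite addr0 mulrSr addrA /= ![a == _]eq_sym => -> ->.
Qed.

End Existence.

(** A labelling that never takes the value [None] and has no source takes the value
    [Some true] at [a - 1] whenever it does at [a], hence is constant. *)
Lemma ex_realizes f : ~~ constant_label f -> exists s, realizes f 1 s.
Proof.
move=> fN; suff [a fa] : exists a, f a = None \/ f a = Some true /\ f (a - 1) != Some true.
  by exists (label_word f a); apply: label_word_realizes.
have [/existsP[a /eqP fa]|] := boolP [exists a, f a == None]; first by exists a; left.
rewrite negb_exists => /forallP fF.
move: fN; rewrite negb_exists => /forallP fN.
have := fN false; rewrite negb_forall => /existsP[a0 fa0].
have {fa0} ta0 : f a0 = Some true by move: fa0 (fF a0); case: (f a0) => [[]|].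
have := fN true; rewrite negb_forall => /existsP[b fb].
have [/existsP[a /andP[/eqP fa fa1]]|] :=
    boolP [exists a, (f a == Some true) && (f (a - 1) != Some true)].
  by exists a; right.
rewrite negb_exists => /forallP fall; case/eqP: fb.
have all_d d : f (a0 - d%:R) = Some true.
  elim: d => [|d IHd]; first by rewrite subr0.
  by have := fall (a0 - d%:R); rewrite IHd eqxx negbK -addrA -opprD -mulrSr => /eqP.
by have := all_d (a0 - b : 'I_n); rewrite natr_Zp opprB addrC subrK.
Qed.

End Labels.

(** * Counting elements by labellings *)

Lemma card_fset_set_image (T : finType) (K : choiceType) (F : T -> K) (A : {set T})
    (S : set K) :
  {in A &, injective F} -> (forall t, t \in A -> S (F t)) ->
  (forall y, S y -> exists2 t, t \in A & F t = y) -> #|` fset_set S| = #|A|.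
Proof.
move=> Finj FS SF.
have -> : S = [set` [fset F t | t in A]%fset]%classic.
  apply/seteqP; split=> y /=.
    by move=> /SF[t tA <-]; apply/imfsetP; exists t.
  by move=> /imfsetP[t /= tA ->]; apply: FS.
by rewrite set_fsetK card_in_imfset //= -cardE.
Qed.

Section CfcCount.

Variable k : nat.
Local Notation n := k.+3.
Local Notation M := (affineA n).
Local Notation wp := (word_prod M).

Lemma full_weight (f : 'I_n -> label) : full f = (weight f == n).
Proof.
rewrite /weight -[X in _ == X]card_ord; apply/forallP/eqP => [fF|e i].
  by rewrite cardsE; apply: eq_card => i; rewrite unfold_in fF.
have /setP/(_ i) : [set i | f i != None] = [set: 'I_n].
  by apply/eqP; rewrite eqEcard finset.subsetT cardsT e leqnn.
by rewrite !inE.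
Qed.

Lemma weight_le (f : 'I_n -> label) : weight f <= n.
Proof. by rewrite -[X in _ <= X]card_ord; apply: max_card. Qed.

(** The labellings of the elements of length [d].  On a full support the element is
    a power, so its length is a positive multiple of [n]; otherwise it has no
    repeated letter. *)
Definition cfc_labels d : {set n.-tuple label} :=
  [set t | [&& valid (tnth t), ~~ constant_label (tnth t) &
    if weight (tnth t) == n then (0 < d) && (n %| d) else weight (tnth t) == d]].

Definition multiplicity (f : 'I_n -> label) d := if weight f == n then d %/ n else 1.

Lemma cfc_labels_mult d t : t \in cfc_labels d ->
  0 < multiplicity (tnth t) d /\ multiplicity (tnth t) d * weight (tnth t) = d.
Proof.
rewrite inE /multiplicity => /and3P[_ _]; case: eqP => [->|_ /eqP->]; last by rewrite mul1n.
by move=> /andP[d0 nd]; rewrite divnK // divn_gt0 // (dvdn_leq d0 nd).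
Qed.

(** Words of a common length with the same labelling have the same projections and
    hence are equal in the group; conversely the labelling can be read off the
    commutation class, which by [fc_word_unique] depends only on the element. *)
Theorem card_CFC_of_length d : #|` fset_set (@CFC_of_length _ M d)| = #|cfc_labels d|.
Proof.
have /choice[W WP] : forall t : n.-tuple label, exists s,
    t \in cfc_labels d -> realizes (tnth t) (multiplicity (tnth t) d) s.
  move=> t; case: (boolP (t \in cfc_labels d)) => [|_]; last by exists [::].
  rewrite inE => /and3P[_ /ex_realizes[s sR] _].
  by exists (flatten (nseq (multiplicity (tnth t) d) s)) => _; apply: realizes_repeat.
have W_cyc t : t \in cfc_labels d -> cyclic_word (W t).
  move=> td; apply: realizes_cyclic_word (WP t td).
  by rewrite /multiplicity full_weight; case: eqP; [right|left].
have W_size t : t \in cfc_labels d -> size (W t) = d.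
  by move=> td; rewrite (realizes_size (WP t td)) (cfc_labels_mult td).2.
apply: (@card_fset_set_image _ _ (fun t => wp (W t))).
- move=> t t' td td' e.
  have WW := fc_word_unique (@gen_inj k) (cyclic_word_fc (W_cyc t td)) (esym e).
  have {WW} WW := WW (eq_leq (etrans (W_size t' td') (esym (W_size t td)))).
  have t'R : realizes (tnth t') (multiplicity (tnth t') d) (W t).
    by move=> i; rewrite (proj_equiv i WW) WP.
  apply: eq_from_tnth => i.
  have [tm _] := cfc_labels_mult td; have [tm' _] := cfc_labels_mult td'.
  move: (td) (td'); rewrite !inE => /andP[tV _] /andP[tV' _].
  by rewrite (realizes_label tm tV (WP t td)) (realizes_label tm' tV' t'R).
- move=> t td; split; first exact: cyclic_word_cfc (W_cyc t td).
  have := fc_word_reduced (@gen_inj k) (cyclic_word_fc (W_cyc t td)).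
  by move=> /reducedP[_ <-]; apply: W_size.
move=> w [wC wd]; have [s sw] := ex_reduced w.
have := cfc_cyclic_word wC sw => /cyclic_word_realizes[m [m0 mf sR]].
pose t := mktuple (label_of s).
have tE : tnth t = label_of s by apply/funext => i; rewrite tnth_mktuple.
have sd : d = m * weight (label_of s).
  by rewrite -(realizes_size sR) -wd; case: sw => _ ->.
have mE : m = multiplicity (tnth t) d.
  rewrite tE /multiplicity sd; case: eqP => [->|/eqP]; first by rewrite mulnK.
  by rewrite -full_weight; case: mf => // ->.
have td : t \in cfc_labels d.
  rewrite inE tE label_of_valid (realizes_nonconstant m0 sR) /=.
  move: mE; rewrite tE /multiplicity sd.
  case: eqP => [->|_ ->]; last by rewrite mul1n.
  by rewrite muln_gt0 m0 dvdn_mull.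
exists t => //; case: sw => <- _; apply: comm_equiv_prod.
have := WP t td; rewrite -mE tE => tR.
exact: realizes_comm_equiv tR sR.
Qed.

End CfcCount.

(** * The transfer matrix *)

Local Open Scope ring_scope.

Lemma big_cons_tuple (R : nmodType) (T : finType) d (F : d.+1.-tuple T -> R) :
  \sum_(t : d.+1.-tuple T) F t = \sum_(a : T) \sum_(u : d.-tuple T) F (cons_tuple a u).
Proof.
rewrite pair_bigA /= (reindex (fun p : T * d.-tuple T => cons_tuple p.1 p.2)) //=.
exists (fun t => (thead t, behead_tuple t)) => [[a u]|t] _ /=.
  by congr (_, _); apply: val_inj.
by apply: val_inj; rewrite /= [in RHS](tuple_eta t).
Qed.

Lemma sum_label (R : nmodType) (F : label -> R) :
  \sum_a F a = F None + F (Some true) + F (Some false).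
Proof.
rewrite (bigD1 None) //= (bigD1 (Some true)) //= (bigD1 (Some false)) //=.
by rewrite big1 ?addr0 ?addrA // => -[[]|].
Qed.

(** Transfer matrix of the labellings: a letter contributes ['X], and validity
    forbids the step from [Some true] to [None]. *)
Definition transfer (a b : label) : {poly int} :=
  match a, b with
  | None, _ => 1
  | Some true, None => 0
  | Some _, _ => 'X
  end.

Fixpoint walk_weight a (s : seq label) b : {poly int} :=
  if s is c :: s' then transfer a c * walk_weight c s' b else transfer a b.

Definition walks d a b : {poly int} := \sum_(t : d.-tuple label) walk_weight a t b.

Lemma walks0 a b : walks 0 a b = transfer a b.
Proof.
rewrite /walks (big_pred1 [tuple]) // => t.
by apply/esym/eqP; apply: val_inj; case/tupleP: t || rewrite (tuple0 t).
Qed.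

Lemma walksS d a b : walks d.+1 a b = \sum_c transfer a c * walks d c b.
Proof.
by rewrite /walks big_cons_tuple; apply: eq_bigr => c _; rewrite big_distrr.
Qed.

(** The row of [Some false] is ['X] times that of [None], so the walks reduce to
    a matrix of size two with trace [1 + 2 * 'X] and determinant ['X]. *)
Lemma walks_rec d a b :
  walks d.+2 a b = (1 + 2 * 'X) * walks d.+1 a b - 'X * walks d a b.
Proof.
have FE e : walks e (Some false) b = 'X * walks e None b.
  case: e => [|e]; first by rewrite !walks0 mulr1.
  by rewrite !walksS !sum_label /=; ring.
have NS e : walks e.+1 None b = (1 + 'X) * walks e None b + walks e (Some true) b.
  by rewrite walksS sum_label /= FE; ring.
have TS e : walks e.+1 (Some true) b = 'X * (walks e (Some true) b + 'X * walks e None b).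
  by rewrite walksS sum_label /= FE; ring.
case: a => [[]|]; rewrite ?FE ?NS ?TS ?NS; ring.
Qed.

(** Closed walks with [d.+1] steps, that is, the trace of the [d.+1]-st power of
    the transfer matrix. *)
Definition closed_walks d := \sum_a walks d a a.

Lemma closed_walks_rec d :
  closed_walks d.+2 = (1 + 2 * 'X) * closed_walks d.+1 - 'X * closed_walks d.
Proof. by rewrite /closed_walks !sum_label !walks_rec; ring. Qed.

Lemma closed_walks0 : closed_walks 0 = 1 + 2 * 'X.
Proof. by rewrite /closed_walks sum_label !walks0 /=; ring. Qed.

Lemma closed_walks1 : closed_walks 1 = 1 + 2 * 'X + 4 * 'X^2.
Proof. by rewrite /closed_walks sum_label !walksS !sum_label !walks0 /=; ring. Qed.

Lemma coef_rec (p q : {poly int}) j :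
  ((1 + 2 * 'X) * p - 'X * q)`_j.+1 = p`_j.+1 + p`_j *+ 2 - q`_j.
Proof. by rewrite mulrDl mul1r -mulrA mulr_natl coefB coefD coefMn !coefXM. Qed.

(** The coefficients that matter for the degree, for the multiples of [n] and for
    the start of the periodicity. *)
Lemma closed_walks_top d :
  [/\ forall j, (d.+1 < j)%N -> (closed_walks d)`_j = 0,
      (closed_walks d)`_d.+1 = 2 ^+ d.+1 & 0 < (closed_walks d)`_d].
Proof.
suff [] : [/\ forall j, (d.+1 < j)%N -> (closed_walks d)`_j = 0,
      (closed_walks d)`_d.+1 = 2 ^+ d.+1 & 0 < (closed_walks d)`_d] /\
   [/\ forall j, (d.+2 < j)%N -> (closed_walks d.+1)`_j = 0,
      (closed_walks d.+1)`_d.+2 = 2 ^+ d.+2 & 0 < (closed_walks d.+1)`_d.+1] by [].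
elim: d => [|d [IH0 [IH1a IH1b IH1c]]].
  have e0 : closed_walks 0 = 1 + 'X *+ 2 by rewrite closed_walks0 mulr_natl.
  have e1 : closed_walks 1 = 1 + 'X *+ 2 + 'X^2 *+ 4 by rewrite closed_walks1 !mulr_natl.
  rewrite e0 e1; split; split; rewrite ?(coefD, coef1, coefMn, coefX, coefXn) //.
    by move=> [|[|j]] // _; rewrite !(coefD, coef1, coefMn, coefX, coefXn).
  by move=> [|[|[|j]]] // _; rewrite !(coefD, coef1, coefMn, coefX, coefXn).
split=> //; case: IH0 => IH0a IH0b IH0c; rewrite closed_walks_rec; split.
- case=> // j jd; rewrite coef_rec IH1a ?IH1a ?IH0a // ?mul0rn ?subr0 //; lia.
- by rewrite coef_rec IH1a // IH1b IH0a // subr0 add0r [RHS]exprS mulr_natl.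
rewrite coef_rec IH1b IH0b exprS mulr_natl mulr2n addrAC addrK.
by rewrite addr_gt0 ?exprn_gt0 // mulrn_wgt0.
Qed.

Section Cycle.
Variable k : nat.
Local Notation n := k.+3.

Lemma transferE a b :
  transfer a b = if (a == Some true) && (b == None) then 0 else 'X^(a != None).
Proof. by case: a b => [[]|] [[]|]. Qed.

Lemma walk_weightE a s b : walk_weight a s b =
  \prod_(i < (size s).+1) transfer (nth None (a :: s) i) (nth None (rcons s b) i).
Proof.
elim: s a => [|c s IHs] a; first by rewrite big_ord1.
by rewrite /= IHs [in RHS]big_ord_recl.
Qed.

Lemma prod_transfer (f : 'I_n -> label) :
  \prod_(i < n) transfer (f i) (f (i + 1)) = if valid f then 'X^(weight f) else 0.
Proof.
case: ifP => [/forallP fV|/negbT].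
  transitivity (\prod_(i < n) ('X : {poly int}) ^+ (f i != None)).
    apply: eq_bigr => i _; rewrite transferE; have := fV i.
    by case: eqP => //= _ /negbTE->.
  rewrite prodrXr /weight -sum1dep_card [in RHS]big_mkcond /=.
  by congr (GRing.exp _ _); apply: eq_bigr => i _; case: (f i).
rewrite negb_forall => /existsP[i]; rewrite negb_imply negbK => fi.
by rewrite (bigD1 i) //= transferE fi mul0r.
Qed.

Theorem weight_generating_function :
  \sum_(t : n.-tuple label | valid (tnth t)) 'X^(weight (tnth t)) = closed_walks k.+2.
Proof.
rewrite big_mkcond big_cons_tuple; apply: eq_bigr => a _; apply: eq_bigr => u _.
rewrite -prod_transfer walk_weightE size_tuple; apply: eq_bigr => i _.
rewrite !(tnth_nth None) /=; congr (transfer _ _).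
have := ltn_ord i; rewrite nth_rcons size_tuple ltnS leq_eqVlt => /orP[/eqP->|lt_i].
  by rewrite ltnn eqxx addn1 modnn.
by rewrite lt_i addn1 modn_small.
Qed.

Lemma card_weight d :
  Posz #|[set t : n.-tuple label | valid (tnth t) & weight (tnth t) == d]| =
  (closed_walks k.+2)`_d.
Proof.
rewrite -weight_generating_function coef_sum -sum1dep_card -natz natr_sum big_mkcondr /=.
by apply: eq_bigr => t _; rewrite coefXn eq_sym; case: eqP.
Qed.

End Cycle.

(** * Coefficients of the series *)

Section Coefficients.
Variable k : nat.
Local Notation n := k.+3.

Lemma constant_full (f : 'I_n -> label) : constant_label f -> full f.
Proof. by move=> /existsP[b /forallP fb]; apply/forallP => i; rewrite (eqP (fb i)). Qed.

Lemma full_valid (f : 'I_n -> label) : full f -> valid f.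
Proof. by move=> /forallP fF; apply/forallP => i; rewrite fF implybT. Qed.

Lemma card_constant : #|[set t : n.-tuple label | constant_label (tnth t)]| = 2.
Proof.
have inj : injective (fun b : bool => [tuple Some b | i < n]).
  by move=> b c /(congr1 (fun t => tnth t ord0)); rewrite !tnth_mktuple => -[].
rewrite -[RHS]card_bool -cardsT -(card_imset [set: bool] inj); apply: eq_card => t.
rewrite inE; apply/existsP/imsetP => [[b /forallP tb]|[b _ ->]]; exists b => //.
  by apply: eq_from_tnth => i; rewrite tnth_mktuple (eqP (tb i)).
by apply/forallP => i; rewrite tnth_mktuple.
Qed.

(** Below length [n] the support is proper and all labellings count.  From length
    [n] on it is full: of the [2 ^+ n] orientations the two cyclic ones are
    excluded, and each of the others gives one element for each multiple of
    [n]. *)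
Lemma CFC_coef d : fcoef (CFC_series (affineA n)) d =
  if (d < n)%N then (closed_walks k.+2)`_d
  else if (n %| d)%N then 2 ^+ n - 2 else 0.
Proof.
rewrite /= card_CFC_of_length; case: (ltnP d n) => [lt_dn|le_nd].
  rewrite -card_weight; congr (Posz #|pred_of_set _|); apply/finset.setP => t; rewrite !inE.
  case: eqP => [->|/eqP wn].
    rewrite gtn_eqF // andbF; apply/negP => /and3P[_ _ /andP[d0 /(dvdn_leq d0)]].
    by rewrite leqNgt lt_dn.
  rewrite (contra (@constant_full _)) ?andTb //; by rewrite full_weight.
have d0 : (0 < d)%N by apply: leq_trans le_nd.
case: ifP => nd; last first.
  apply/eqP; rewrite eqz_nat cards_eq0; apply/eqP/finset.setP => t; rewrite !inE nd andbF.
  case: eqP => wn; rewrite ?andbF //; apply/negP => /and3P[_ _ /eqP wd].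
  have := weight_le (tnth t); rewrite wd leq_eqVlt ltnNge le_nd orbF => /eqP dn.
  by rewrite dn dvdnn in nd.
have [_ top _] := closed_walks_top k.+2.
rewrite -top -card_weight -(cardsID [set t : n.-tuple label | constant_label (tnth t)]).
rewrite PoszD [X in Posz #|pred_of_set X| + _](_ : _ =
  [set t : n.-tuple label | constant_label (tnth t)]).
  rewrite card_constant addrAC subrr add0r; congr (Posz #|pred_of_set _|).
  apply/finset.setP => t; rewrite !inE d0 nd; case: eqP => wn; first by rewrite !andbT andbC.
  rewrite !andbF; apply/negbTE/negP => /and3P[_ _ /eqP wd].
  by case: wn; apply/eqP; rewrite eqn_leq weight_le wd.
apply/finset.setP => t; rewrite !inE -full_weight; case: (boolP (constant_label _)) => tC.
  by rewrite (constant_full tC) (full_valid (constant_full tC)).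
by rewrite andbF.
Qed.

End Coefficients.

Section PowerSeries.
Variable R : comUnitRingType.

Lemma fpsXnE m : fpsX R ^+ m = fps_poly 'X^m.
Proof. by rewrite rmorphXn. Qed.

Lemma fcoefXnM m (f : fps R) d :
  fcoef (fpsX R ^+ m * f) d = if (d < m)%N then 0 else fcoef f (d - m).
Proof.
rewrite fpsXnE fcoefM; case: ltnP => dm.
  rewrite big1 // => -[j jd] _ /=; rewrite coefXn ltn_eqF ?mul0r //.
  exact: leq_ltn_trans dm.
rewrite (bigD1 (Ordinal (dm : (m < d.+1)%N))) //= coefXn eqxx mul1r big1 ?addr0 //.
by move=> j; rewrite -val_eqE /= coefXn => /negbTE->; rewrite mul0r.
Qed.

Lemma inv_one_sub_Xn m : (0 < m)%N ->
  (1 - fpsX R ^+ m)^-1 = FPS (fun d => (m %| d)%N%:R).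
Proof.
move=> m0; apply: mulr1_eq; apply: fpsP => d.
rewrite mulrBl mul1r fcoefD fcoefN fcoefXnM fcoef1 /=; case: ltnP => dm.
  by rewrite subr0; case: d dm => [|d] dm; rewrite ?dvdn0 ?gtnNdvd.
by rewrite dvdn_subl // subrr gtn_eqF // (leq_trans m0).
Qed.

End PowerSeries.

(** The trace of the [d.+1]-st power of the transfer matrix, without the two cyclic
    orientations: [d] is the index of the affine diagram, which has [d.+1]
    nodes. *)
Definition cfc_poly d : {poly int} := closed_walks d - 2 * 'X^(d.+1).

Lemma coef_cfc_poly d j : (cfc_poly d)`_j = (closed_walks d)`_j - (if j == d.+1 then 2 else 0).
Proof. by rewrite /cfc_poly coefB mulr_natl coefMn coefXn; case: eqP. Qed.

Lemma size_cfc_poly d : (0 < d)%N -> size (cfc_poly d) = d.+2.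
Proof.
case: d => // d _; have [z top _] := closed_walks_top d.+1; apply/anti_leq/andP; split.
  by apply/leq_sizeP => j dj; rewrite coef_cfc_poly z // gtn_eqF // subr0.
rewrite ltnNge; apply/negP => /leq_sizeP/(_ _ (leqnn _)).
rewrite coef_cfc_poly eqxx top => /eqP; rewrite subr_eq0 !exprS.
have : 0 < 2 ^+ d :> int by rewrite exprn_gt0.
by move=> ? /eqP; lia.
Qed.

(** The characteristic polynomial is the product of that of the closed walks and of
    the factor with root ['X], which comes from the subtracted term. *)
Lemma cfc_poly_rec d : cfc_poly d.+3 =
  (3 * 'X + 1) * cfc_poly d.+2 - (2 * 'X + 2 * 'X^2) * cfc_poly d.+1 + 'X^2 * cfc_poly d.
Proof. by rewrite /cfc_poly !closed_walks_rec !exprS; ring. Qed.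

Lemma cfc_poly1 : cfc_poly 1 = 1 + 2 * 'X + 2 * 'X^2.
Proof. by rewrite /cfc_poly closed_walks1; ring. Qed.

Lemma cfc_poly2 : cfc_poly 2 = 1 + 3 * 'X + 6 * 'X^2 + 6 * 'X^3.
Proof. by rewrite /cfc_poly closed_walks_rec closed_walks1 closed_walks0; ring. Qed.

Lemma cfc_poly3 : cfc_poly 3 = 1 + 4 * 'X + 10 * 'X^2 + 16 * 'X^3 + 14 * 'X^4.
Proof. by rewrite /cfc_poly !closed_walks_rec closed_walks1 closed_walks0; ring. Qed.

(** * Rational form and periodicity *)

Lemma fcoefCM (R : comUnitRingType) (c : R) (f : fps R) d :
  fcoef (fpsC c * f) d = c * fcoef f d.
Proof.
rewrite fcoefM big_ord_recl /= coefC /= subn0 big1 ?addr0 // => i _.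
by rewrite coefC /= mul0r.
Qed.

Lemma fcoef_shifts (R : comUnitRingType) (f g h l : fps R) d :
  fcoef (f - fpsX R ^+ 1 * g + fpsX R ^+ 2 * h - fpsX R ^+ 3 * l) d =
  fcoef f d - (if (d < 1)%N then 0 else fcoef g (d - 1))
    + (if (d < 2)%N then 0 else fcoef h (d - 2))
    - (if (d < 3)%N then 0 else fcoef l (d - 3)).
Proof. by rewrite !(fcoefD, fcoefN) !fcoefXnM. Qed.

(** Multiplying by the denominator, a cubic polynomial in [x], turns the identity
    into the recurrence and its initial values.  The term in [x ^+ 3] of the
    numerator is what [cfc_poly 0 = 1] would contribute to the recurrence. *)
Lemma generating_function :
  let q := fpsC ('X : {poly int}) in
  let x := fpsX {poly int} in
  FPS (fun n => if (1 <= n)%N then cfc_poly n else 0) =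
    x * (1 + 2 * q + 2 * q ^+ 2 - (2 * q + 2 * q ^+ 2) * x + q ^+ 2 * x ^+ 2)
    / ((1 - q * x) * (1 - (2 * q + 1) * x + q * x ^+ 2)).
Proof.
move=> q x; set F := FPS _; set N := x * _; set D := (1 - q * x) * _.
pose c1 : {poly int} := 1 + 3 * 'X; pose c2 : {poly int} := 2 * 'X + 2 * 'X^2.
pose c3 : {poly int} := 'X^2; pose c0 : {poly int} := 1 + 2 * 'X + 2 * 'X^2.
have fpsCE : [/\ fpsC c1 = 1 + 3 * q, fpsC c2 = 2 * q + 2 * q ^+ 2, fpsC c3 = q ^+ 2
    & fpsC c0 = 1 + 2 * q + 2 * q ^+ 2].
  by split; rewrite /fpsC /q ?(rmorphD, rmorphM, rmorph_nat, rmorphXn, rmorph1).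
case: fpsCE => e1 e2 e3 e0.
have DE : D = fpsC 1 - x ^+ 1 * fpsC c1 + x ^+ 2 * fpsC c2 - x ^+ 3 * fpsC c3.
  by rewrite e1 e2 e3 /D; ring.
have NE : N = fpsC 0 - x ^+ 1 * fpsC (- c0) + x ^+ 2 * fpsC (- c2) - x ^+ 3 * fpsC (- c3).
  have fpsCN c : fpsC (- c) = - fpsC c :> fps {poly int} by rewrite /fpsC !rmorphN.
  by rewrite !fpsCN e2 e3 e0 /fpsC !rmorph0 /N; ring.
have DU : D \is a GRing.unit.
  by rewrite fps_unitE DE fcoef_shifts /= coefC subr0 addr0 subr0 unitr1.
apply: (mulIr DU); rewrite divrK //.
have -> : F * D = F - x ^+ 1 * (fpsC c1 * F) + x ^+ 2 * (fpsC c2 * F) - x ^+ 3 * (fpsC c3 * F).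
  by rewrite DE; ring.
rewrite NE; apply: fpsP => d; rewrite !fcoef_shifts !fcoefCM /= !coefC.
have cfc_poly0 : cfc_poly 0 = 1 by rewrite /cfc_poly closed_walks0 expr1; ring.
case: d => [|[|[|[|d]]]] /=; rewrite ?subn1 ?subn2 ?subnn /=
  ?(mulr0, subr0, addr0, sub0r, add0r, opprK) //.
- by rewrite cfc_poly1.
- by rewrite cfc_poly2 cfc_poly1 /c1 /c2; ring.
- by rewrite cfc_poly3 cfc_poly2 cfc_poly1 /c1 /c2 /c3; ring.
by rewrite !subSS !subn0 /= cfc_poly_rec /c1 /c2 /c3; ring.
Qed.

Lemma CFC_series_form k :
  CFC_series (affineA k.+3) = fps_poly (cfc_poly k.+2)
    + (2 ^+ k.+3 - 2) / (1 - fpsX int ^+ k.+3) * fpsX int ^+ (2 * k.+3).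
Proof.
set n := k.+3; apply: fpsP => d; rewrite inv_one_sub_Xn // [_ * fpsX _ ^+ _]mulrC.
have -> : 2 ^+ n - 2 = fpsC (2 ^+ n - 2 : int).
  by rewrite /fpsC !(rmorphB, rmorphXn, rmorph_nat).
rewrite fcoefD fcoefXnM fcoefCM CFC_coef [fcoef (fps_poly _) d]/= coef_cfc_poly -/n [fcoef _ _]/=.
have [z top _] := closed_walks_top k.+2; have [lt_dn|lt_nd|->] := ltngtP d n.
- by rewrite subr0 (_ : (d < 2 * n)%N) ?addr0 //; lia.
- rewrite z // subr0 add0r; case: ltnP => d2n.
    rewrite ifF //; apply/negP => /dvdnP[c ec]; move: lt_nd d2n; rewrite ec.
    by rewrite ltn_mul2r -{1}[n]mul1n !ltn_mul2r /=; lia.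
  by rewrite dvdn_subl ?dvdn_mull //; case: (n %| d)%N; rewrite ?mulr1 ?mulr0.
by rewrite dvdnn top (_ : (n < 2 * n)%N) ?addr0 // -{1}[n]mul1n ltn_mul2r.
Qed.

(** From length [n] on the coefficients are [2 ^+ n - 2 != 0] at the multiples of
    [n] and [0] elsewhere, so every period is a multiple of [n].  At length [n - 1]
    the coefficient is positive, whereas it vanishes at [2 * n - 1]. *)
Lemma CFC_periodic k : let a := fcoef (CFC_series (affineA k.+3)) in
  exact_period a k.+3 /\ periodicity_starts_at a k.+3 k.+3.
Proof.
set n := k.+3 => a.
have a_ge d : (n <= d)%N -> a d = if (n %| d)%N then 2 ^+ n - 2 else 0.
  by move=> nd; rewrite /a CFC_coef ltnNge nd.
have per : periodic_from a n n.
  by move=> d nd; rewrite !a_ge ?dvdn_addl // (leq_trans nd) // leq_addr.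
have c_neq0 : 2 ^+ n - 2 != 0 :> int.
  have : 0 < 2 ^+ k.+1 :> int by rewrite exprn_gt0.
  by rewrite subr_eq0 /n !exprS; lia.
split; split=> //; first by split=> //; exists n.
  move=> N [N0 [L perN]]; pose j := (L.+1 * n)%N.
  have jn : (n <= j)%N by rewrite leq_pmull.
  have nj : (n %| j)%N by rewrite dvdn_mull.
  have jL : (L <= j)%N by rewrite (leq_trans (leqnSn L)) // leq_pmulr.
  have : a (j + N)%N = if (n %| N)%N then 2 ^+ n - 2 else 0.
    by rewrite a_ge ?dvdn_addr // (leq_trans jn) // leq_addr.
  rewrite perN // a_ge // nj.
  by case: ifP => [/(dvdn_leq N0) //|_ /eqP]; rewrite (negbTE c_neq0).
move=> L perL; rewrite leqNgt; apply/negP; rewrite ltnS => le_L.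
have := perL _ le_L; rewrite a_ge ?leq_addl // dvdn_addl // gtnNdvd //.
have [_ _ pos] := closed_walks_top k.+2.
by rewrite /a CFC_coef ltnSn => e; move: pos; rewrite -e Order.POrderTheory.ltxx.
Qed.

Theorem proposition2p4 :
  exists P : nat -> {poly int},
  [/\ forall n : nat, (3 <= n)%N ->
        CFC_series (affineA n) =
          fps_poly (P (n - 1)%N)
          + (2 ^+ n - 2) / (1 - fpsX int ^+ n) * fpsX int ^+ (2 * n)
        /\ size (P (n - 1)%N) = n.+1,
      forall n : nat, (4 <= n)%N ->
        P n = (3 * 'X + 1) * P (n - 1)%N
              - (2 * 'X + 2 * 'X^2) * P (n - 2)%N
              + 'X^2 * P (n - 3)%N,
      [/\ P 1%N = 1 + 2 * 'X + 2 * 'X^2,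
          P 2%N = 1 + 3 * 'X + 6 * 'X^2 + 6 * 'X^3
        & P 3%N = 1 + 4 * 'X + 10 * 'X^2 + 16 * 'X^3 + 14 * 'X^4],
      (let q := fpsC ('X : {poly int}) in
       let x := fpsX {poly int} in
       FPS (fun n => if (1 <= n)%N then P n else 0) =
         x * (1 + 2 * q + 2 * q ^+ 2 - (2 * q + 2 * q ^+ 2) * x
              + q ^+ 2 * x ^+ 2)
         / ((1 - q * x) * (1 - (2 * q + 1) * x + q * x ^+ 2)))
    & forall n : nat, (3 <= n)%N ->
        exact_period (fcoef (CFC_series (affineA n))) n
        /\ periodicity_starts_at (fcoef (CFC_series (affineA n))) n n].
Proof.
exists cfc_poly; split.
- case=> [|[|[|k]]] // _; rewrite subn1; split; [exact: CFC_series_form|exact: size_cfc_poly].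
- by case=> [|[|[|[|n]]]] // _; rewrite !subSS !subn0; apply: cfc_poly_rec.
- by split; [apply: cfc_poly1|apply: cfc_poly2|apply: cfc_poly3].
- exact: generating_function.
by case=> [|[|[|k]]] // _; apply: CFC_periodic.
Qed.
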